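(* Consider the unsupervised multitask Gaussian mixture problem ($\eta_1=\eta_2=0$) with $T=2$ tasks, $N_1=N_2=D$ (sampling ratios $\alpha_1=\alpha_2=1$), task correlation $C_{12}=c$ with $|c|<1$, and signal-to-noise ratios $\lambda_1,\lambda_2>0$, with overlaps as defined in the context. Then the classification is impossible (that is, $q_{u1}=q_{u2}=0$) if and only if $(\lambda_1,\lambda_2)$ belongs to the region $$\Big\{(\lambda_1,\lambda_2)\in[0,1]^2:\ (1-\lambda_1^2)(1-\lambda_2^2)\ge c^4\lambda_1^2\lambda_2^2\Big\}.$$
   Context: Overlaps in the unsupervised case. Let $\sigma_t=\lambda_t^{-1/2}$, $\mathbf C=\begin{pmatrix}1&c\\c&1\end{pmatrix}$, $\mathbf M=\big(C_{tt'}/(\sigma_t\sigma_{t'})\big)_{t,t'=1}^2$ and $F(q)=\mathbb E[\tanh(\sqrt q\,Z+q)]$ for $q\ge0$, with $Z\sim\mathcal N(0,1)$. The overlaps $(q_{ut},q_{vt})_{t=1}^2$ (nonnegative numbers) are the stable solution of the fixed-point equations $$q_{ut}=\big[\mathbf M-\mathbf M(\mathbf I+\mathbf D\mathbf M)^{-1}\big]_{tt},\qquad q_{vt}=F(q_{ut}),\qquad t=1,2,$$ where $\mathbf D=\operatorname{diag}(\alpha_tq_{vt})_{t=1}^2$ and $\alpha_1=\alpha_2=1$. Here a solution is called stable if it is a (Lyapunov) stable fixed point, on $[0,\infty)^2$, of the iteration $\mathbf q_u\mapsto G(\mathbf q_u)$, $G_t(\mathbf q_u)=[\mathbf M-\mathbf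 M(\mathbf I+\mathbf D\mathbf M)^{-1}]_{tt}$ with $\mathbf D=\operatorname{diag}(\alpha_sF(q_{us}))_{s=1}^2$. The zero vector is always a solution; when there are several solutions the overlaps are, by convention, the stable one. Classification of task $t$ is called impossible if $q_{ut}=0$ and feasible if $q_{ut}>0$. *)

(* Defs.v *)
From HB Require Import structures.
From mathcomp Require Export all_boot all_order all_algebra.
From mathcomp Require Export all_classical all_reals all_analysis.

Set Implicit Arguments.
Unset Strict Implicit.
Unset Printing Implicit Defensive.

Export numFieldNormedType.Exports.
Import Order.TTheory GRing.Theory Num.Theory.

Local Open Scope ring_scope.

Definition tanh (R : realType) (x : R) : R :=
  (expR x - expR (- x)) / (expR x + expR (- x)).

(* The integrand is bounded, so the expectation is finite and [fine] loses
   nothing.  The second parameter of [normal_prob] is the standard deviation. *)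
Definition gauss_overlap (R : realType) (q : R) : R :=
  fine ('E_(normal_prob (0 : R) 1)[fun z : R => tanh (Num.sqrt q * z + q)]).

Definition noise_level (R : realType) (lambda : R) : R :=
  lambda `^ (- 2^-1).

(* The matrix with entries C_tt' / (sigma_t sigma_t'). *)
Definition snr_mx (R : realType) (T : nat) (C : 'M[R]_T) (lambda : 'I_T -> R) :
    'M[R]_T :=
  \matrix_(t, t') (C t t' / (noise_level (lambda t) * noise_level (lambda t'))).

Definition qu_of_qv (R : realType) (T : nat) (C : 'M[R]_T)
    (lambda alpha : 'I_T -> R) (qv : 'rV[R]_T) : 'rV[R]_T :=
  let M := snr_mx C lambda in
  let D := diag_mx (\row_t (alpha t * qv 0 t)) in
  \row_t (M - M *m invmx (1%:M + D *m M)) t t.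

Definition qv_of_qu (R : realType) (T : nat) (qu : 'rV[R]_T) : 'rV[R]_T :=
  \row_t gauss_overlap (qu 0 t).

Definition overlap_map (R : realType) (T : nat) (C : 'M[R]_T)
    (lambda alpha : 'I_T -> R) (qu : 'rV[R]_T) : 'rV[R]_T :=
  qu_of_qv C lambda alpha (qv_of_qu qu).

Definition nonneg_row (R : realType) (T : nat) (q : 'rV[R]_T) : Prop :=
  forall t, 0 <= q 0 t.

(* Lyapunov stability of [q] for the iteration of [G] on the nonnegative
   orthant; the norm on row vectors is the sup norm. *)
Definition lyapunov_stable (R : realType) (T : nat)
    (G : 'rV[R]_T -> 'rV[R]_T) (q : 'rV[R]_T) : Prop :=
  forall eps : R, 0 < eps -> exists2 delta : R, 0 < delta &
    forall x : 'rV[R]_T, nonneg_row x -> `|x - q| < delta ->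
      forall n : nat, `|iter n G x - q| < eps.

(* The unsupervised overlaps: nonnegative solutions of the fixed-point
   equations that are stable. *)
Definition is_overlaps (R : realType) (T : nat) (C : 'M[R]_T)
    (lambda alpha : 'I_T -> R) (qu qv : 'rV[R]_T) : Prop :=
  [/\ nonneg_row qu, nonneg_row qv,
      qu = qu_of_qv C lambda alpha qv, qv = qv_of_qu qu &
      lyapunov_stable (overlap_map C lambda alpha) qu].

Definition impossible_task (R : realType) (T : nat) (qu : 'rV[R]_T) (t : 'I_T) :
  Prop := qu 0 t = 0.

Definition corr_mx2 (R : realType) (c : R) : 'M[R]_2 :=
  \matrix_(t, t') (if t == t' then 1 else c).

Definition impossible_region (R : realType) (c : R) : set (R * R) :=
  [set l | [/\ 0 <= l.1 <= 1, 0 <= l.2 <= 1 &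
    (1 - l.1 ^+ 2) * (1 - l.2 ^+ 2) >= c ^+ 4 * l.1 ^+ 2 * l.2 ^+ 2]]%classic.

(* Main.v *)
Require Import Defs.
From mathcomp Require Import measurable_realfun ring lra.

Set Implicit Arguments.
Unset Strict Implicit.
Unset Printing Implicit Defensive.

Import Order.TTheory GRing.Theory Num.Theory.

Local Open Scope ring_scope.

(* The map [G] is monotone, bounded and strictly subhomogeneous
   ([s G x < G (s x)] for [0 < s < 1] wherever [G x] is positive), and
   [G (x + e) <= G x + L e]. Its largest fixed point [q] (Knaster-Tarski) is stable:
   the vectors [s q] are subsolutions, and the largest fixed points of [G + d]
   are supersolutions that decrease to [q]. Any other fixed point [w <= q] is
   unstable or equal to [q]: where [w] vanishes but [q] does not, iterates of
   [max w (s q)] grow geometrically; if the supports agree, strict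
   subhomogeneity gives [w = q].

   For the Gaussian expectation [F = gauss_overlap], a translation of the density yields
   [F q = 1 - expR (- q / 2) E (1 / cosh (sqrt q Z))], whose integrand is
   pointwise increasing in [q] and star-shaped; with [E cosh (a Z) = expR (a ^ 2 / 2)]
   this also gives [F q < q] for [q > 0] and [F q / q] arbitrarily close to 1 near 0.

   Finally [q = 0] exactly when the linearisation [[l^2, k], [k, m^2]],
   [k = c^2 l m], has spectral radius at most 1: [G] lies below its linearisation
   and [F q < q], while an expanding direction of the linearisation provides
   a nonzero subsolution. *)

(** * Subhomogeneous monotone maps *)

Section SubhomogeneousMaps.
Context (R : realType) (T : nat).
Implicit Types (x y q w : 'rV[R]_T) (G : 'rV[R]_T -> 'rV[R]_T).

Definition le_row x y := forall t, x 0 t <= y 0 t.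

Lemma row_norm_lt x (e : R) : 0 < e ->
  (`|x| < e) <-> (forall t, `|x 0 t| < e).
Proof.
move=> e0; have -> : `|x| = mx_norm x by [].
rewrite mx_normrE; split.
  by move=> /bigmax_ltP[_ h] t; apply: (h (ord0, t)).
move=> h; apply/bigmax_ltP; split => // -[i t] _ /=.
by rewrite (ord1 i).
Qed.

Record bounded_monotone G (B : 'rV[R]_T) : Prop := BoundedMonotone {
  bm_nonneg : forall x, nonneg_row x -> nonneg_row (G x) ;
  bm_mono : forall x y, nonneg_row x -> le_row x y -> le_row (G x) (G y) ;
  bm_bound : forall x, nonneg_row x -> le_row (G x) B }.

Lemma nonneg_row_le x y : nonneg_row x -> le_row x y -> nonneg_row y.
Proof. by move=> x0 xy t; apply: le_trans (xy t). Qed.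

Definition max_fixpoint G q :=
  [/\ nonneg_row q, G q = q &
      forall x, nonneg_row x -> le_row x (G x) -> le_row x q].

(** The coordinatewise supremum [q] of the subsolutions [x <= G x] is finite because of [B], and is
    again a subsolution by monotonicity. Then [G q] is a subsolution too, so it lies below [q]. *)
Lemma exists_max_fixpoint G B : bounded_monotone G B ->
  exists q, max_fixpoint G q.
Proof.
move=> [Gnn Gmono Gbd].
pose S := [set x | nonneg_row x /\ le_row x (G x)]%classic.
pose St t := [set x 0 t | x in S]%classic.
pose q := \row_t sup (St t).
have S0 : S 0.
  split; first by move=> t; rewrite mxE.
  by move=> t; rewrite mxE; apply: Gnn => s; rewrite mxE.
have ubS t : has_ubound (St t).
  exists (B 0 t) => _ [x [x0 xG] <-].
  exact: le_trans (xG t) (Gbd _ x0 t).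
have Sq x : S x -> le_row x q.
  by move=> Sx t; rewrite mxE; apply: ub_le_sup (ubS t) _ _; exists x.
have q0 : nonneg_row q by move=> t; have := Sq _ S0 t; rewrite mxE.
have qG : le_row q (G q).
  move=> t; rewrite {1}/q mxE; apply: ge_sup; first by exists (0 : R); exists 0; rewrite ?mxE.
  move=> _ [x Sx <-]; case: (Sx) => x0 xG.
  by apply: le_trans (xG t) _; apply: Gmono => //; exact: Sq.
exists q; split => //; last by move=> x x0 xG; exact: Sq.
apply/rowP => t; apply/eqP; rewrite eq_le qG andbT.
by apply: Sq; split; [exact: Gnn|exact: Gmono].
Qed.

(** Strictness in [sh_sub] is asked only at positive coordinates of [G x], so that fixed points with
    vanishing coordinates remain possible. The one-sided [sh_lip] acts as continuity from above. *)
Record subhomogeneous_map G (B : 'rV[R]_T) (L : R) : Prop := SubhomogeneousMap {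
  sh_bm : bounded_monotone G B ;
  sh_sub : forall x s t, nonneg_row x -> 0 < s < 1 -> 0 < G x 0 t ->
    s * G x 0 t < G (s *: x) 0 t ;
  sh_lip : forall x e, nonneg_row x -> 0 <= e ->
    le_row (G (x + const_mx e)) (G x + const_mx (L * e)) }.

(** * Stability and uniqueness of the maximal fixed point *)

Section Fix.
Variables (G : 'rV[R]_T -> 'rV[R]_T) (B : 'rV[R]_T) (L : R).
Hypothesis HG : subhomogeneous_map G B L.

Let Gnn := bm_nonneg (sh_bm HG).
Let Gmono := bm_mono (sh_bm HG).

Lemma nonneg_rowZ s x : 0 <= s -> nonneg_row x -> nonneg_row (s *: x).
Proof. by move=> s0 x0 t; rewrite mxE mulr_ge0. Qed.

Lemma subhomogeneous_le x s : nonneg_row x -> 0 <= s <= 1 ->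
  le_row (s *: G x) (G (s *: x)).
Proof.
move=> x0 /andP[s0 s1] t; rewrite mxE.
have [->|sn0] := eqVneq s 0.
  by rewrite mul0r; apply: Gnn => u; rewrite mxE mul0r.
have [->|sn1] := eqVneq s 1; first by rewrite mul1r scale1r.
have := Gnn x0 t; rewrite le_eqVlt => /orP[/eqP<-|Gx0].
  by rewrite mulr0; apply: Gnn; exact: nonneg_rowZ.
by apply/ltW/(sh_sub HG) => //; rewrite !lt_neqAle s0 s1 sn1 eq_sym sn0.
Qed.

(* The perturbed map [G + d] has a maximal fixed point [u_d]; as [d] tends to 0
   the infimum of the [u_d] is a subsolution of [G], so [u_d] tends to [q].  *)
Lemma supersolution_near q eps : max_fixpoint G q -> 0 < eps ->
  exists u d, [/\ 0 < d, le_row (G u) u,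
    forall t, q 0 t + d <= u 0 t & forall t, u 0 t <= q 0 t + eps].
Proof.
move=> [q0 Gq qmax] eps0.
pose Gd (d : R) x := G x + const_mx d.
have cmx (d : R) t : (const_mx d : 'rV[R]_T) 0 t = d by rewrite mxE.
have addE x (d : R) t : (x + const_mx d) 0 t = x 0 t + d by rewrite !mxE.
have bmd d : 0 < d -> bounded_monotone (Gd d) (B + const_mx d).
  move=> d0; split.
  - by move=> x x0 t; rewrite addE addr_ge0//; [exact: Gnn|exact: ltW].
  - by move=> x y x0 xy t; rewrite !addE lerD2r; apply: Gmono.
  - by move=> x x0 t; rewrite !addE lerD2r; apply: (bm_bound (sh_bm HG)).
have /choice[u Hu] : forall d, exists x, 0 < d -> max_fixpoint (Gd d) x.
  move=> d; case: (boolP (0 < d)) => d0; last by exists 0.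
  by have [x hx] := exists_max_fixpoint (bmd d d0); exists x.
have unn d : 0 < d -> nonneg_row (u d) by move=> /Hu[].
have uE d t : 0 < d -> u d 0 t = G (u d) 0 t + d.
  by move=> /Hu[_ e _]; rewrite -{1}e addE.
have umono d d' : 0 < d -> d <= d' -> le_row (u d) (u d').
  move=> d0 dd'; have [_ _ h] := Hu d' (lt_le_trans d0 dd').
  apply: h; first exact: unn.
  by move=> t; rewrite addE uE// lerD2l.
pose l : 'rV[R]_T := \row_t inf [set u d 0 t | d in [set d | 0 < d]]%classic.
have hasl t : has_inf [set u d 0 t | d in [set d : R | 0 < d]]%classic.
  split; first by exists (u 1 0 t); exists 1 => //=; exact: ltr01.
  by exists 0 => _ [d /= d0 <-]; apply: unn.
have lu d : 0 < d -> le_row l (u d).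
  by move=> d0 t; rewrite mxE; apply: ge_inf; [exact: (hasl t).2|exists d].
have l0 : nonneg_row l.
  move=> t; rewrite mxE; apply: lb_le_inf; first exact: (hasl t).1.
  by move=> _ [d /= d0 <-]; apply: unn.
(* The smallest of the finitely many [dt t] serves all coordinates at once, since [u d] increases
   with [d]. *)
have near_l eta : 0 < eta -> exists2 d, 0 < d <= eta & forall t, u d 0 t <= l 0 t + eta.
  move=> eta0.
  have /choice[dt Hdt] : forall t, exists d, 0 < d /\ u d 0 t <= l 0 t + eta.
    move=> t; have [_ [d /= d0 <-] h] := inf_adherent eta0 (hasl t).
    by exists d; split => //; rewrite [l 0 t]mxE ltW.
  exists (\big[Num.min/eta]_t dt t).
    rewrite bigmin_le_id andbT; apply: lt_bigmin => // t _; by case: (Hdt t).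
  move=> t; have [dt0] := Hdt t; apply: le_trans.
  apply: umono; last exact: bigmin_le.
  by apply: lt_bigmin => // s _; case: (Hdt s).
(* Here [l <= u d = G (u d) + d <= G (l + eta) + eta <= G l + (L + 1) eta], and [eta] is chosen to
   make the excess at most [e]. *)
have lq : le_row l q.
  apply: qmax => // t; apply/ler_addgt0Pr => e e0.
  pose eta := e / (`|L| + 1).
  have L1 : 0 < `|L| + 1 by rewrite ltr_wpDl.
  have eta0 : 0 < eta by rewrite divr_gt0.
  have [d /andP[d0 deta] hd] := near_l _ eta0.
  apply: (le_trans (lu d d0 t)); rewrite uE//.
  have ul : le_row (u d) (l + const_mx eta) by move=> s; rewrite addE.
  have := Gmono (unn d d0) ul t; have := sh_lip HG l0 (ltW eta0) t.
  rewrite addE => h1 h2.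
  have : L * eta + eta <= e.
    have -> : e = (`|L| + 1) * eta by rewrite /eta mulrC divfK// gt_eqF.
    by rewrite mulrDl mul1r lerD2r ler_pM2r// ler_norm.
  by lra.
have [d /andP[d0 _] hd] := near_l _ eps0.
exists (u d), d; split => //.
- by move=> t; rewrite uE// lerDl ltW.
- move=> t; rewrite uE// lerD2r -{1}Gq; apply: Gmono => //.
  have [_ _ h] := Hu d d0; apply: h => // s.
  by rewrite addE Gq lerDl ltW.
- by move=> t; apply: le_trans (hd t) _; rewrite lerD2r.
Qed.

(** The order interval from [s q] to [u] is invariant under [G], lies within [eps] of [q], and
    contains every nonnegative vector close enough to [q]. *)
Lemma max_fixpoint_stable q : max_fixpoint G q -> lyapunov_stable G q.
Proof.
move=> Mq eps eps0; have [q0 Gq qmax] := Mq.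
have e2 : 0 < eps / 2 by rewrite divr_gt0.
have [u [d [d0 Gu qu uq]]] := supersolution_near Mq e2.
(* [K] exceeds [eps] and every coordinate of [q], so [s] lies in [(0, 1)] and
   [(1 - s) q <= eps / 2]. *)
pose K := \big[Num.max/1]_t q 0 t + eps.
have K1 : 1 <= \big[Num.max/1]_t q 0 t by exact: bigmax_ge_id.
have K0 : 0 < K by rewrite /K; lra.
have qK t : q 0 t <= K.
  by rewrite (@le_trans _ _ (\big[Num.max/1]_t q 0 t)) ?le_bigmax// /K lerDl ltW.
pose s := 1 - eps / 2 / K.
have epsK : 0 < eps / 2 / K < 1.
  by rewrite divr_gt0//= ltr_pdivrMr// mul1r /K; lra.
have s01 : 0 < s < 1 by rewrite /s; lra.
have sq t : q 0 t - eps / 2 <= s * q 0 t.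
  rewrite /s mulrBl mul1r lerD2l lerN2.
  by rewrite mulrAC ler_pdivrMr// ler_pM2l.
(* The bound [d] ensures [x <= u]; the other terms ensure [s q <= x] where [q] is positive. Where
   [q] vanishes, this is nonnegativity of [x]. *)
exists (\big[Num.min/d]_(t | 0 < q 0 t) ((1 - s) * q 0 t)).
  apply: lt_bigmin => // t qt; rewrite mulr_gt0//; lra.
move=> x x0; rewrite row_norm_lt; last first.
  by apply: lt_bigmin => // t qt; rewrite mulr_gt0//; lra.
move=> xq.
have lo : le_row (s *: q) x.
  move=> t; rewrite mxE; have := q0 t; rewrite le_eqVlt => /orP[/eqP<-|qt].
    by rewrite mulr0.
  have := xq t; rewrite !mxE => h.
  have := lt_le_trans h (bigmin_le_cond d (fun t => (1 - s) * q 0 t) qt).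
  by rewrite ltr_norml => /andP[]; nra.
have hi : le_row x u.
  move=> t; have := xq t; rewrite !mxE => h.
  have := lt_le_trans h (bigmin_le_id _ _ _ _).
  by rewrite ltr_norml => /andP[_]; have := qu t; lra.
have sq0 : nonneg_row (s *: q) by apply: nonneg_rowZ => //; lra.
move=> n; rewrite row_norm_lt//.
have [ln un] : le_row (s *: q) (iter n G x) /\ le_row (iter n G x) u.
  elim: n => [//|n [ln un]] /=.
  have xn0 := nonneg_row_le sq0 ln; split => t.
    apply: le_trans (Gmono sq0 ln t).
    rewrite -{1}Gq; apply: subhomogeneous_le => //; lra.
  by apply: le_trans (Gu t); apply: Gmono.
move=> t; rewrite !mxE; have := ln t; have := un t; have := uq t; have := sq t.
by rewrite mxE ltr_norml; lra.
Qed.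

Lemma expr_unbounded (k C : R) : 1 < k -> exists n, C < k ^+ n.
Proof.
move=> k1; have bern n : 1 + n%:R * (k - 1) <= k ^+ n.
  elim: n => [|n IH]; first by rewrite mul0r addr0 expr0.
  rewrite exprS -natr1; have n0 : 0 <= n%:R :> R by [].
  have : k * (1 + n%:R * (k - 1)) <= k * k ^+ n by rewrite ler_pM2l// (lt_trans ltr01).
  have : 0 <= n%:R * (k - 1) ^+ 2 :> R by rewrite mulr_ge0 ?sqr_ge0.
  by rewrite expr2; lra.
exists (Num.bound `|C / (k - 1)|); apply: lt_le_trans (bern _).
have : C / (k - 1) < (Num.bound `|C / (k - 1)|)%:R.
  by apply: le_lt_trans (ler_norm _) _; exact: archi_boundP.
by rewrite ltr_pdivrMr ?subr_gt0//; lra.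
Qed.

(** Strict subhomogeneity at [q / 2] gives a gain above 1 at each positive coordinate. Writing
    [s q = 2 s (q / 2)] carries the smallest gain to all [s <= 1 / 2]. *)
Lemma subhomogeneous_growth q : nonneg_row q -> G q = q ->
  exists2 k : R, 1 < k & forall s : R, 0 <= s <= 1 / 2 ->
    le_row ((k * s) *: q) (G (s *: q)).
Proof.
move=> q0 Gq; pose r t := G ((1 / 2) *: q) 0 t / (1 / 2 * q 0 t).
(* The default 2 keeps the factor above 1 even when [q = 0]. *)
exists (\big[Num.min/2]_(t | 0 < q 0 t) r t).
  apply: lt_bigmin => [|t qt]; first by lra.
  rewrite /r ltr_pdivlMr ?mul1r; last by rewrite mulr_gt0//; lra.
  by rewrite -{1}Gq; apply: (sh_sub HG) => //; rewrite ?Gq//; lra.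
set k := \big[_/_]_(_ | _) _; move=> s s12 t.
have h0 : nonneg_row ((1 / 2) *: q) by apply: nonneg_rowZ => //; lra.
have -> : s *: q = (2 * s) *: ((1 / 2) *: q).
  by rewrite scalerA; congr (_ *: _); field.
apply: le_trans (subhomogeneous_le h0 _ t); last by lra.
rewrite !mxE; have := q0 t; rewrite le_eqVlt => /orP[/eqP<-|qt].
  by rewrite mulr0 mulr_ge0 ?Gnn//; lra.
have : k <= r t by exact: bigmin_le_cond.
rewrite /r ler_pdivlMr; last by rewrite mulr_gt0//; lra.
have -> : k * s * q 0 t = 2 * s * (k * (1 / 2 * q 0 t)) by field.
by move=> h; apply: ler_wpM2l => //; lra.
Qed.

(** If [w] vanished at [t] but [q] did not, the orbit of [max w (a q)], started as close to [w] as
    desired, would dominate [min (a k ^ n) (1 / 2) q] and so reach [q / 2] at [t]. *)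
Lemma stable_fixpoint_support q w t : max_fixpoint G q ->
  nonneg_row w -> G w = w -> lyapunov_stable G w -> w 0 t = 0 -> q 0 t = 0.
Proof.
move=> [q0 Gq qmax] w0 Gw stw wt; apply/eqP; rewrite eq_le q0 andbT leNgt.
apply/negP => qt.
have [k k1 grow] := subhomogeneous_growth q0 Gq.
have e0 : 0 < 1 / 2 * q 0 t by rewrite mulr_gt0//; lra.
have [d d0 hd] := stw _ e0.
pose K := \big[Num.max/1]_t q 0 t.
have K1 : 1 <= K by exact: bigmax_ge_id.
pose a := Num.min (1 / 2) (d / 2 / K).
have a0 : 0 < a by rewrite lt_min !divr_gt0// (lt_le_trans ltr01).
have aq s : a * q 0 s < d.
  have qK : q 0 s <= K by apply: le_bigmax.
  have : a <= d / 2 / K by rewrite ge_min lexx orbT.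
  rewrite ler_pdivlMr ?(lt_le_trans ltr01)// => h.
  by have := ler_wpM2l (ltW a0) qK; lra.
pose x : 'rV[R]_T := \row_s Num.max (w 0 s) (a * q 0 s).
have wx : le_row w x by move=> s; rewrite mxE le_max lexx.
have x0 := nonneg_row_le w0 wx.
have xw : `|x - w| < d.
  rewrite row_norm_lt// => s; rewrite !mxE ger0_norm ?subr_ge0 ?le_max ?lexx//.
  rewrite ltrBlDr gt_max; have := aq s; have := w0 s; lra.
(* The cap 1/2 keeps [b n] in the range where the growth estimate applies. *)
pose b n := Num.min (a * k ^+ n) (1 / 2).
have b01 n : 0 <= b n <= 1 / 2.
  rewrite /b ge_min lexx orbT andbT le_min; apply/andP; split; last by lra.
  by rewrite mulr_ge0 ?exprn_ge0//; lra.
have bS n : b n.+1 <= k * b n.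
  rewrite /b minr_pMr; last by lra.
  rewrite le_min !ge_min exprS; apply/andP; split; first by rewrite mulrCA lexx.
  by apply/orP; right; lra.
have inv n : le_row w (iter n G x) /\ le_row (b n *: q) (iter n G x).
  elim: n => [|n [wn qn]] /=.
    split => // s; rewrite !mxE le_max; apply/orP; right.
    by apply: ler_wpM2r => //; rewrite /b expr0 mulr1 ge_min lexx.
  split => s; first by rewrite -{1}Gw; apply: Gmono.
  have bq0 : nonneg_row (b n *: q) by apply: nonneg_rowZ => //; case/andP: (b01 n).
  apply: le_trans (Gmono bq0 qn s); apply: le_trans (grow _ (b01 n) s).
  by rewrite !mxE ler_wpM2r.
have [n hn] := expr_unbounded (1 / 2 / a) k1.
have := hd x x0 xw n; rewrite row_norm_lt//.
move=> /(_ t); rewrite !mxE wt subr0.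
have [_ /(_ t)] := inv n; rewrite mxE.
have -> : b n = 1 / 2.
  rewrite /b; apply/min_idPr; move: hn; rewrite ltr_pdivrMr// => hn.
  by rewrite [a * _]mulrC ltW.
by move=> h; rewrite ltNge (le_trans h)// ler_norm.
Qed.

(** As [w] is positive wherever [q] is, some [s > 0] is the largest number up to 1 with [s q <= w].
    If [s < 1], then [s q = s G q < G (s q) <= G w = w] at the positive coordinates, contradicting
    maximality. *)
Lemma stable_fixpoint_unique q w : max_fixpoint G q ->
  nonneg_row w -> G w = w -> lyapunov_stable G w -> w = q.
Proof.
move=> Mq w0 Gw stw; have [q0 Gq qmax] := Mq.
have wq : le_row w q by apply: qmax => // t; rewrite Gw.
have wpos t : 0 < q 0 t -> 0 < w 0 t.
  move=> qt; rewrite lt_def w0 andbT; apply/negP => /eqP wt.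
  by rewrite (stable_fixpoint_support Mq w0 Gw stw wt) ltxx in qt.
pose s := \big[Num.min/1]_(t | 0 < q 0 t) (w 0 t / q 0 t).
have s0 : 0 < s by apply: lt_bigmin => // t qt; rewrite divr_gt0 ?wpos.
have sqw : le_row (s *: q) w.
  move=> t; rewrite mxE; have := q0 t; rewrite le_eqVlt => /orP[/eqP<-|qt].
    by rewrite mulr0.
  by rewrite -ler_pdivlMr//; exact: bigmin_le_cond.
have s1 : 1 <= s.
  rewrite leNgt; apply/negP => s1.
  suff : s < \big[Num.min/1]_(t | 0 < q 0 t) (w 0 t / q 0 t) by rewrite ltxx.
  apply: lt_bigmin => // t qt; rewrite ltr_pdivlMr//.
  have sq0 : nonneg_row (s *: q) by apply: nonneg_rowZ => //; exact: ltW.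
  rewrite -[w]Gw; apply: lt_le_trans (Gmono sq0 sqw t).
  by rewrite -{1}Gq; apply: (sh_sub HG); rewrite ?s0 ?Gq.
apply/rowP => t; apply/eqP; rewrite eq_le wq /=; apply: le_trans (sqw t).
by rewrite mxE ler_peMl.
Qed.

End Fix.
End SubhomogeneousMaps.

(** * Hyperbolic functions *)

Section Hyperbolic.
Local Open Scope classical_set_scope.
Context {R : realType}.
Implicit Types (a r x y : R).

Definition cosh x : R := (expR x + expR (- x)) / 2.
Definition sinh x : R := (expR x - expR (- x)) / 2.

Lemma cosh0 : cosh 0 = 1.
Proof. by rewrite /cosh oppr0 expR0; field. Qed.

Lemma coshN x : cosh (- x) = cosh x.
Proof. by rewrite /cosh opprK addrC. Qed.

Lemma cosh_norm x : cosh `|x| = cosh x.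
Proof. by case: (ger0P x) => // _; rewrite coshN. Qed.

Lemma sinh0 : sinh 0 = 0.
Proof. by rewrite /sinh oppr0 subrr mul0r. Qed.

Lemma expRxNx x : expR x * expR (- x) = 1.
Proof. by rewrite -expRD subrr expR0. Qed.

Lemma cosh_gt0 x : 0 < cosh x.
Proof. by rewrite divr_gt0// addr_gt0 ?expR_gt0. Qed.

Lemma cosh2_sinh2 x : cosh x ^+ 2 = 1 + sinh x ^+ 2.
Proof.
apply/eqP; rewrite -subr_eq0; apply/eqP.
transitivity (expR x * expR (- x) - 1); last by rewrite expRxNx subrr.
by rewrite /cosh /sinh; field.
Qed.

Lemma cosh_ge1 x : 1 <= cosh x.
Proof.
have := cosh2_sinh2 x; have := sqr_ge0 (sinh x); have := cosh_gt0 x.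
by rewrite !expr2; nra.
Qed.

Lemma sech_gt0 x : 0 < (cosh x)^-1.
Proof. by rewrite invr_gt0 cosh_gt0. Qed.

Lemma sech_le1 x : (cosh x)^-1 <= 1.
Proof. by rewrite invf_le1 ?cosh_gt0 ?cosh_ge1. Qed.

Lemma cosh_double x : cosh (2 * x) = 2 * cosh x ^+ 2 - 1.
Proof.
transitivity ((expR x * expR x + expR (- x) * expR (- x)) / 2).
  by rewrite -!expRD /cosh; congr ((expR _ + expR _) / _); ring.
by have := expRxNx x; rewrite /cosh; nra.
Qed.

Lemma is_derive_cosh x : is_derive x 1 cosh (sinh x).
Proof.
rewrite /cosh /sinh; apply: is_derive_eq.
by rewrite !scaler0 add0r /GRing.scale /=; ring.
Qed.

Lemma is_derive_sinh x : is_derive x 1 sinh (cosh x).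
Proof.
rewrite /cosh /sinh; apply: is_derive_eq.
by rewrite !scaler0 add0r /GRing.scale /=; ring.
Qed.


Lemma sinh_ge x : 0 <= x -> x <= sinh x.
Proof.
move=> x0; have d y : is_derive y 1 (fun z => z - sinh z) (1 - cosh y).
  by have := is_derive_sinh y => ?; apply: is_derive_eq.
have := @ler0_derive1_nincr R (fun z => z - sinh z) 0 x.
move=> /(_ _ _ _ 0 x) h; rewrite -subr_le0 -[leRHS](_ : 0 - sinh 0 = 0); last first.
  by rewrite sinh0 subrr.
apply: h => //.
- by move=> y _; rewrite derive1E derive_val subr_le0 cosh_ge1.
- apply: continuous_subspaceT => y; apply: differentiable_continuous.
  by apply/derivable1_diffP; have := d y => -[].
Qed.

Lemma le_cosh x y : `|x| <= `|y| -> cosh x <= cosh y.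
Proof.
rewrite -(cosh_norm x) -(cosh_norm y).
move: `|x| `|y| (normr_ge0 x) => {x y} u v u0 uv.
rewrite /cosh ler_pM2r ?invr_gt0// -subr_ge0.
have -> : expR v + expR (- v) - (expR u + expR (- u)) =
    (expR v - expR u) * (1 - expR (- u) * expR (- v)).
  rewrite mulrBr mulr1 mulrBl [expR v * _]mulrCA expRxNx mulr1.
  by rewrite [expR u * (_ * _)]mulrA expRxNx; ring.
rewrite mulr_ge0 ?subr_ge0 ?ler_expR// -expRD -expR0 ler_expR; lra.
Qed.

Lemma is_derive_sech_slope x : 0 < x ->
  is_derive x 1 (fun z => (1 - (cosh z)^-1) / z ^+ 2)
    ((x * sinh x / cosh x ^+ 2 - 2 * (1 - (cosh x)^-1)) / x ^+ 3).
Proof.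
move=> x0; have := is_derive_cosh x => dc.
have c0 := cosh_gt0 x.
have ds : is_derive x 1 (fun z : R => (cosh z)^-1) (- cosh x ^- 2 *: sinh x).
  by apply: is_deriveV; rewrite gt_eqF.
have dx2 : is_derive x 1 (fun z : R => (z ^+ 2)^-1) (- (x ^+ 2) ^- 2 *: (2 * x)).
  apply: is_deriveV; first by rewrite gt_eqF// exprn_gt0.
  by apply: is_derive_eq; rewrite /GRing.scale /=; ring.
apply: is_derive_eq; rewrite /GRing.scale /=.
by field; rewrite !gt_eqF.
Qed.

(** After clearing denominators, [x sinh x <= sinh x ^ 2 = cosh x ^ 2 - 1], and the gap to
    [2 (cosh x ^ 2 - cosh x)] is [(cosh x - 1) ^ 2]. *)
Lemma sech_slope_le0 x : 0 <= x ->
  x * sinh x / cosh x ^+ 2 <= 2 * (1 - (cosh x)^-1).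
Proof.
move=> x0; have c0 := cosh_gt0 x; have c1 := cosh_ge1 x.
have sx := sinh_ge x0; have e := cosh2_sinh2 x.
rewrite ler_pdivrMr ?exprn_gt0//.
have -> : 2 * (1 - (cosh x)^-1) * cosh x ^+ 2 = 2 * (cosh x ^+ 2 - cosh x).
  by field; rewrite gt_eqF.
have : x * sinh x <= sinh x ^+ 2 by rewrite expr2 ler_wpM2r// (le_trans x0).
by have := sqr_ge0 (cosh x - 1); rewrite !expr2 in e *; nra.
Qed.

(** The quotient [(1 - 1 / cosh z) / z ^ 2] is nonincreasing for [z > 0]; compare it at [r x] and
    [x]. The power [r ^ 2] suits the later choice [r = sqrt s]. *)
Lemma sech_star r x : 0 <= r <= 1 ->
  (cosh (r * x))^-1 <= 1 - r ^+ 2 + r ^+ 2 * (cosh x)^-1.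
Proof.
move=> /andP[r0 r1].
have [->|rn0] := eqVneq r 0; first by rewrite mul0r cosh0 invr1; lra.
have rp : 0 < r by rewrite lt_def rn0.
rewrite -(cosh_norm (r * x)) -(cosh_norm x) normrM (ger0_norm r0).
have := normr_ge0 x; rewrite le_eqVlt => /orP[/eqP<-|].
  by rewrite mulr0 cosh0 invr1; lra.
move: `|x| => {}x x0; have rx0 : 0 < r * x by rewrite mulr_gt0.
have rx : r * x <= x by rewrite ler_piMl// ltW.
have d y : 0 < y -> derivable (fun z : R => (1 - (cosh z)^-1) / z ^+ 2) y 1.
  by move=> y0; have [] := is_derive_sech_slope y0.
have := @ler0_derive1_nincr R (fun z => (1 - (cosh z)^-1) / z ^+ 2) (r * x) x.
move=> /(_ _ _ _ (r * x) x (lexx _) rx (lexx _)) h.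
have {h} : (1 - (cosh x)^-1) / x ^+ 2 <= (1 - (cosh (r * x))^-1) / (r * x) ^+ 2.
  apply: h.
  - by move=> y; rewrite in_itv => /andP[/(lt_trans rx0) y0 _]; exact: d.
  - move=> y; rewrite in_itv => /andP[/(lt_trans rx0) y0 _].
    have dy := is_derive_sech_slope y0; rewrite derive1E derive_val.
    rewrite pmulr_lle0 ?invr_gt0 ?exprn_gt0// subr_le0.
    exact/sech_slope_le0/ltW.
  - apply: derivable_within_continuous => y; rewrite in_itv => /andP[y1 _].
    by apply: d; exact: lt_le_trans y1.
rewrite ler_pdivrMr ?exprn_gt0// mulrAC ler_pdivlMr ?exprn_gt0// exprMn.
have x2 : 0 < x ^+ 2 by rewrite exprn_gt0.
by rewrite mulrA ler_pM2r//; lra.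
Qed.

Lemma sech_ge x : 2 - cosh x <= (cosh x)^-1.
Proof.
have c0 := cosh_gt0 x; rewrite -[_^-1]mul1r ler_pdivlMr//.
by have := sqr_ge0 (cosh x - 1); rewrite expr2; lra.
Qed.

(** This is [(cosh x - 1) ^ 3 >= 0] divided by [cosh x], with [cosh x ^ 2] linearised by the double
    angle formula so that Gaussian means become explicit. *)
Lemma sech_le x : (cosh x)^-1 <= 7 / 2 - 3 * cosh x + cosh (2 * x) / 2.
Proof.
have c0 := cosh_gt0 x; have c1 := cosh_ge1 x; rewrite cosh_double.
rewrite -[_^-1]mul1r ler_pdivrMr//.
have : 0 <= (cosh x - 1) ^+ 3 by rewrite exprn_ge0// subr_ge0.
by rewrite !exprS expr0; lra.
Qed.

Lemma expRN_star t r : 0 <= r <= 1 ->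
  expR (- (r * t)) <= 1 - r + r * expR (- t).
Proof.
move=> /andP[r0 r1]; have := convex_expR (Itv01 r0 r1) (- t : R^o) (0 : R^o).
rewrite !convRE /= expR0 mulr0 addr0 mulr1 mulrN.
by rewrite [r * _ + _]addrC.
Qed.

Lemma continuous_cosh : continuous cosh.
Proof.
move=> x; apply: differentiable_continuous; apply/derivable1_diffP.
by have := is_derive_cosh x => -[].
Qed.

End Hyperbolic.

(** * Gaussian integrals *)

Section GaussianWeight.
Local Open Scope classical_set_scope.
Context {R : realType}.
Implicit Types (f g : R -> R) (a x y : R).
Local Notation mu := (@lebesgue_measure R).
Local Notation phi := (@normal_pdf R 0 1).

(** The Radon-Nikodym derivative of the law is known only almost everywhere, so it is identified
    with the density by comparing integrals over measurable sets. *)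
Lemma integral_normal_prob f : measurable_fun setT f ->
  (normal_prob (0 : R) 1).-integrable setT (EFin \o f) ->
  (\int[normal_prob (0 : R) 1]_x (f x)%:E = \int[mu]_x (f x * phi x)%:E)%E.
Proof.
move=> mf intf.
have dom := @normal_prob_dominates R 0 1.
rewrite -(Radon_Nikodym_change_of_variables dom)//=.
under [RHS]eq_integral do rewrite EFinM.
apply: ae_eq_integral => //.
- by apply: emeasurable_funM => //; exact/measurable_EFinP.
- apply: emeasurable_funM => //=; first exact/measurable_EFinP.
  by apply/measurable_EFinP; exact: measurable_normal_pdf.
- apply: ae_eqe_mul2l => /=.
  rewrite Radon_NikodymE//=.
  case: cid => /= h [h1 h2 h3].
  apply: integral_ae_eq => //=.
    by apply/measurable_EFinP; exact: measurable_normal_pdf.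
  by move=> E E01 mE; rewrite -h3.
Qed.

Lemma normal_pdf_shift a y :
  phi (y + a) = expR (- (a * y) - a ^+ 2 / 2) * phi y.
Proof.
rewrite !normal_pdfE ?oner_neq0// mulrCA; congr (_ * _).
rewrite /normal_fun -expRD expr1n; congr expR; by field.
Qed.

Lemma ge0_integral_shift g a : continuous g -> (forall x, 0 <= g x) ->
  (\int[mu]_x (g x)%:E = \int[mu]_x (g (x + a))%:E)%E.
Proof.
move=> cg g0.
have dE : (fun x : R => x + a)^`() = cst 1.
  by apply/funext => x; rewrite derive1E deriveD// derive_id derive_cst addr0.
rewrite (@increasing_ge0_integration_by_substitutionT R (fun x => x + a) g)//.
- by apply: eq_integral => x _; rewrite !fctE dE /= mulr1.
- by move=> x y xy; rewrite ltrD2r.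
- by rewrite dE => x; exact: cvg_cst.
- by rewrite dE; exact: is_cvg_cst.
- by rewrite dE; exact: is_cvg_cst.
- exact: cvg_addrr_Ny.
- exact: cvg_addrr.
Qed.

Definition gauss_integrable f := mu.-integrable setT (fun x => (f x * phi x)%:E).

(** The expectation is written against Lebesgue measure because translation invariance is used on
    it. *)
Definition gauss_mean f : R := \int[mu]_x (f x * phi x).

Lemma gauss_integrable_cst (c : R) : gauss_integrable (cst c).
Proof.
rewrite /gauss_integrable; under eq_fun do rewrite EFinM.
by apply: integrableZl => //; exact: integrable_normal_pdf.
Qed.

Lemma gauss_mean_cst (c : R) : gauss_mean (cst c) = c.
Proof.
rewrite /gauss_mean RintegralZl//; last exact: integrable_normal_pdf.
by rewrite /Rintegral integral_normal_pdf /= mulr1.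
Qed.

Lemma gauss_integrable_bounded f (c : R) : measurable_fun setT f ->
  (forall x, `|f x| <= c) -> gauss_integrable f.
Proof.
move=> mf fc; apply: le_integrable (gauss_integrable_cst c) => //.
  by apply/measurable_EFinP/measurable_funM => //; exact: measurable_normal_pdf.
move=> x _; rewrite lee_fin !normrM ler_wpM2r//.
by rewrite (le_trans (fc x))// ler_norm.
Qed.

Lemma gauss_integrableD f g : gauss_integrable f -> gauss_integrable g ->
  gauss_integrable (fun x => f x + g x).
Proof.
move=> fi gi; rewrite /gauss_integrable; under eq_fun do rewrite mulrDl EFinD.
exact: integrableD.
Qed.

Lemma gauss_meanD f g : gauss_integrable f -> gauss_integrable g ->
  gauss_mean (fun x => f x + g x) = gauss_mean f + gauss_mean g.
Proof.
move=> fi gi; rewrite /gauss_mean -RintegralD//.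
by apply: eq_Rintegral => x _; rewrite mulrDl.
Qed.

Lemma gauss_integrableZ f (c : R) : gauss_integrable f ->
  gauss_integrable (fun x => c * f x).
Proof.
move=> fi; rewrite /gauss_integrable; under eq_fun do rewrite -mulrA EFinM.
exact: integrableZl.
Qed.

Lemma gauss_meanZ f (c : R) : gauss_integrable f ->
  gauss_mean (fun x => c * f x) = c * gauss_mean f.
Proof.
move=> fi; rewrite /gauss_mean -RintegralZl//.
by apply: eq_Rintegral => x _; rewrite mulrA.
Qed.

Lemma le_gauss_mean f g : gauss_integrable f -> gauss_integrable g ->
  (forall x, f x <= g x) -> gauss_mean f <= gauss_mean g.
Proof.
move=> fi gi fg; apply: le_Rintegral => // x _.
by rewrite ler_wpM2r ?normal_pdf_ge0.
Qed.

(** Completing the square turns an exponential factor into a translation of the density. *)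
Lemma gauss_expRE a x :
  expR (a * x) * phi x = expR (a ^+ 2 / 2) * phi (x + - a).
Proof.
rewrite normal_pdf_shift mulrA -expRD; congr (expR _ * _); by field.
Qed.

Lemma integral_pdf_shift a : (\int[mu]_x (phi (x + a))%:E = 1)%E.
Proof.
rewrite -ge0_integral_shift ?integral_normal_pdf//.
- exact: continuous_normal_pdf.
- by move=> x; exact: normal_pdf_ge0.
Qed.

Lemma integrable_pdf_shift a : mu.-integrable setT (fun x => (phi (x + a))%:E).
Proof.
have m : measurable_fun setT (fun x => phi (x + a)).
  apply: measurableT_comp; first exact: measurable_normal_pdf.
  exact: measurable_funD.
apply/integrableP; split; first exact/measurable_EFinP.
under eq_integral do rewrite /= ger0_norm ?normal_pdf_ge0//.
by rewrite integral_pdf_shift ltry.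
Qed.

Lemma gauss_integrable_expR a : gauss_integrable (fun x => expR (a * x)).
Proof.
rewrite /gauss_integrable; under eq_fun do rewrite gauss_expRE EFinM.
by apply: integrableZl => //; exact: integrable_pdf_shift.
Qed.

Lemma gauss_mean_expR a : gauss_mean (fun x => expR (a * x)) = expR (a ^+ 2 / 2).
Proof.
rewrite /gauss_mean; under eq_Rintegral do rewrite gauss_expRE.
rewrite RintegralZl//; last exact: integrable_pdf_shift.
by rewrite /Rintegral integral_pdf_shift mulr1.
Qed.

End GaussianWeight.

(** * Properties of the scalar function [F = gauss_overlap] *)

Section GaussOverlap.
Local Open Scope classical_set_scope.
Context {R : realType}.
Implicit Types (a q r s t u v w x y : R).
Local Notation mu := (@lebesgue_measure R).
Local Notation phi := (@normal_pdf R 0 1).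

Lemma one_sub_tanh x : 1 - tanh x = expR (- x) / cosh x.
Proof.
rewrite /tanh /cosh; field.
by rewrite gt_eqF// addr_gt0 ?expR_gt0.
Qed.

Lemma tanhE x : tanh x = 1 - expR (- x) / cosh x.
Proof. by rewrite -one_sub_tanh opprB addrCA subrr addr0. Qed.

Lemma continuous_sech_lin a : continuous (fun y => (cosh (a * y))^-1).
Proof.
move=> y; apply: cvgV; first by rewrite gt_eqF ?cosh_gt0.
apply: (@continuous_comp _ _ _ ( *%R a) cosh); last exact: continuous_cosh.
exact: mulrl_continuous.
Qed.

Lemma gauss_integrable_sech a : gauss_integrable (fun y => (cosh (a * y))^-1).
Proof.
apply: (@gauss_integrable_bounded _ _ 1).
  by apply: continuous_measurable_fun; exact: continuous_sech_lin.
by move=> y; rewrite gtr0_norm ?sech_gt0// sech_le1.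
Qed.

Lemma measurable_tanh_affine a q : measurable_fun setT (fun y => tanh (a * y + q)).
Proof.
under eq_fun do rewrite tanhE.
apply: continuous_measurable_fun => y.
have lin : {for y, continuous (fun y => a * y + q)}.
  by apply: cvgD; [exact: mulrl_continuous|exact: cvg_cst].
apply: cvgB; first exact: cvg_cst.
apply: cvgM.
  apply: (@continuous_comp _ _ _ (fun y => - (a * y + q)) expR).
    by apply: cvgN; exact: lin.
  exact: continuous_expR.
apply: cvgV; first by rewrite gt_eqF ?cosh_gt0.
apply: (@continuous_comp _ _ _ (fun y => a * y + q) cosh); first exact: lin.
exact: continuous_cosh.
Qed.

Lemma tanh_le1 x : `|tanh x| <= 1.
Proof.
have D : 0 < expR x + expR (- x) by rewrite addr_gt0 ?expR_gt0.
rewrite /tanh normrM normfV (gtr0_norm D) ler_pdivrMr// mul1r.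
by rewrite ler_norml; have := expR_gt0 x; have := expR_gt0 (- x); lra.
Qed.

(* With [w = a (y + a)] one has [1 - tanh w = expR (- w) / cosh w], and
   [expR (- w)] is exactly the factor that turns the density at [y] into the
   density at [y + a], up to the constant [expR (- a ^+ 2 / 2)]. *)
Lemma one_sub_tanh_pdf a y :
  (1 - tanh (a * y + a ^+ 2)) * phi y =
  expR (- (a ^+ 2 / 2)) * (cosh (a * (y + a)))^-1 * phi (y + a).
Proof.
rewrite one_sub_tanh normal_pdf_shift.
have -> : a * (y + a) = a * y + a ^+ 2 by ring.
have -> : expR (- (a * y + a ^+ 2)) =
    expR (- (a ^+ 2 / 2)) * expR (- (a * y) - a ^+ 2 / 2).
  by rewrite -expRD; congr expR; field.
by ring.
Qed.

(** Passing to [1 - tanh] yields a nonnegative integrand, which is translated by [a = sqrt q] using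
    [one_sub_tanh_pdf]. *)
Lemma gauss_overlapE q : 0 <= q -> gauss_overlap q =
  1 - expR (- (q / 2)) * gauss_mean (fun y => (cosh (Num.sqrt q * y))^-1).
Proof.
move=> q0; set a := Num.sqrt q; have aq : a ^+ 2 = q by rewrite sqr_sqrtr.
have mt := @measurable_tanh_affine a q.
have it : gauss_integrable (fun y => tanh (a * y + q)).
  by apply: (@gauss_integrable_bounded _ _ 1) => // y; exact: tanh_le1.
rewrite /gauss_overlap unlock integral_normal_prob//; last first.
  apply: measurable_bounded_integrable => //.
    by rewrite /= probability_setT ltry.
  exists 1; split => // M M1 y _ /=.
  by apply: le_trans (tanh_le1 _) _; exact: ltW.
rewrite -[fine _]/(gauss_mean (fun y => tanh (a * y + q))).
have -> : gauss_mean (fun y => tanh (a * y + q)) =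
    1 - gauss_mean (fun y => 1 - tanh (a * y + q)).
  have -> : (fun y => 1 - tanh (a * y + q)) =
      (fun y => cst 1 y + (-1) * tanh (a * y + q)).
    by apply/funext => y; rewrite mulN1r.
  rewrite gauss_meanD ?gauss_mean_cst ?gauss_meanZ//.
  - by ring.
  - exact: gauss_integrable_cst.
  - exact: gauss_integrableZ.
congr (1 - _); rewrite -gauss_meanZ; last exact: gauss_integrable_sech.
rewrite /gauss_mean /Rintegral; congr fine.
rewrite [RHS](@ge0_integral_shift _ _ a) => [|x|x]; last 2 first.
- apply: cvgM; last by apply: continuous_normal_pdf; rewrite oner_neq0.
  by apply: cvgM; [exact: cvg_cst|exact: continuous_sech_lin].
- by rewrite !mulr_ge0 ?expR_ge0 ?invr_ge0 ?normal_pdf_ge0// ltW ?cosh_gt0.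
by apply: eq_integral => y _; rewrite -aq one_sub_tanh_pdf.
Qed.

Local Notation sech_mean a := (gauss_mean (fun y => (cosh (a * y))^-1)).

Lemma gauss_integrable_cosh a : gauss_integrable (fun y => cosh (a * y)).
Proof.
have -> : (fun y => cosh (a * y)) =
    (fun y => 2^-1 * expR (a * y) + 2^-1 * expR ((- a) * y)).
  by apply/funext => y; rewrite /cosh mulNr; field.
by apply: gauss_integrableD; apply: gauss_integrableZ; exact: gauss_integrable_expR.
Qed.

Lemma gauss_mean_cosh a : gauss_mean (fun y => cosh (a * y)) = expR (a ^+ 2 / 2).
Proof.
have -> : (fun y => cosh (a * y)) =
    (fun y => 2^-1 * expR (a * y) + 2^-1 * expR ((- a) * y)).
  by apply/funext => y; rewrite /cosh mulNr; field.
have h b := gauss_integrableZ (2^-1 : R) (gauss_integrable_expR b).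
rewrite (gauss_meanD (h a) (h (- a))) !(gauss_meanZ _ (gauss_integrable_expR _)).
rewrite !gauss_mean_expR; by rewrite sqrrN; field.
Qed.

Lemma gauss_overlap0 : gauss_overlap (0 : R) = 0.
Proof.
rewrite gauss_overlapE// sqrtr0 mul0r oppr0 expR0 mul1r.
under eq_fun do rewrite mul0r cosh0 invr1.
by rewrite (gauss_mean_cst 1) subrr.
Qed.

Lemma le_gauss_overlap q r : 0 <= q -> q <= r ->
  gauss_overlap q <= gauss_overlap r.
Proof.
move=> q0 qr; have r0 := le_trans q0 qr.
rewrite (gauss_overlapE q0) (gauss_overlapE r0) lerD2l lerN2.
apply: ler_pM; first exact: expR_ge0.
- rewrite -(gauss_mean_cst 0); apply: le_gauss_mean.
  + exact: gauss_integrable_cst.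
  + exact: gauss_integrable_sech.
  + by move=> y; rewrite ltW ?sech_gt0.
- by rewrite ler_expR lerN2 ler_pM2r ?invr_gt0.
- apply: le_gauss_mean; try exact: gauss_integrable_sech.
  move=> y; rewrite lef_pV2 ?posrE ?cosh_gt0// le_cosh// !normrM ler_wpM2r//.
  by rewrite !ger0_norm ?sqrtr_ge0// ler_sqrt.
Qed.

Lemma gauss_overlap_ge0 q : 0 <= q -> 0 <= gauss_overlap q.
Proof. by move=> q0; rewrite -gauss_overlap0 le_gauss_overlap. Qed.

(** The product of the two upper bounds falls short of the right-hand side by
    [s (1 - s) (1 - t) (1 - w)]. *)
Lemma star_mul s t u v w : 0 <= s <= 1 -> 0 < u -> 0 < v -> t <= 1 -> w <= 1 ->
  u <= 1 - s + s * t -> v <= 1 - s + s * w ->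
  u * v <= 1 - s + s * (t * w).
Proof.
move=> /andP[s0 s1] u0 v0 t1 w1 hu hv.
have := ler_pM (ltW u0) (ltW v0) hu hv.
have : 0 <= s * (1 - s) * ((1 - t) * (1 - w)) by rewrite !mulr_ge0 ?subr_ge0.
by lra.
Qed.

(* The integrand [1 - expR (- q / 2) / cosh (sqrt q y)] already has this property
   for each fixed [y]. *)
Lemma gauss_overlap_star s q : 0 <= q -> 0 <= s <= 1 ->
  s * gauss_overlap q <= gauss_overlap (s * q).
Proof.
move=> q0 /andP[s0 s1].
rewrite (gauss_overlapE q0) (gauss_overlapE (mulr_ge0 s0 q0)).
set a := Num.sqrt q; set b := Num.sqrt (s * q).
have ha := gauss_integrable_sech a; have hb := gauss_integrable_sech b.
have hza := gauss_integrableZ (expR (- (q / 2))) ha.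
have hzb := gauss_integrableZ (expR (- (s * q / 2))) hb.
have hsa := gauss_integrableZ s hza.
have h1 := gauss_integrable_cst (1 - s).
suff : gauss_mean (fun y => expR (- (s * q / 2)) * (cosh (b * y))^-1) <=
  gauss_mean (fun y => cst (1 - s) y + s * (expR (- (q / 2)) * (cosh (a * y))^-1)).
  rewrite (gauss_meanD h1 hsa) gauss_mean_cst (gauss_meanZ s hza).
  rewrite (gauss_meanZ (expR (- (q / 2))) ha) (gauss_meanZ (expR (- (s * q / 2))) hb).
  by move: (gauss_mean _) (gauss_mean _) => A B; lra.
apply: (le_gauss_mean hzb); first exact: gauss_integrableD h1 hsa.
move=> y /=; have sr : Num.sqrt s ^+ 2 = s by rewrite sqr_sqrtr.
have sr01 : 0 <= Num.sqrt s <= 1 by rewrite sqrtr_ge0 -sqrtr1 ler_sqrt.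
have := sech_star (a * y) sr01; rewrite sr [Num.sqrt s * _]mulrA -sqrtrM//.
have s01 : 0 <= s <= 1 by rewrite s0.
have := expRN_star (q / 2) s01; rewrite [s * (q / 2)]mulrA.
have v0 : 0 < (cosh (b * y))^-1 by exact: sech_gt0.
have w1 : (cosh (a * y))^-1 <= 1 by exact: sech_le1.
have u0 := expR_gt0 (- (s * q / 2)).
have t1 : expR (- (q / 2)) <= 1 by rewrite -expR0 ler_expR oppr_le0 divr_ge0.
rewrite -/b => hu hv; exact: star_mul.
Qed.

(** From [1 / cosh >= 2 - cosh] one gets [F q <= 2 - 2 expR (- q / 2)], and this is below [q] by the
    strict tangent bound on [expR]. *)
Lemma gauss_overlap_lt q : 0 < q -> gauss_overlap q < q.
Proof.
move=> q0; rewrite gauss_overlapE ?ltW//.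
set a := Num.sqrt q; have aq : a ^+ 2 = q by rewrite sqr_sqrtr// ltW.
have hk := gauss_integrable_cst (2 : R).
have hc := gauss_integrable_cosh a; have hz := gauss_integrableZ (-1) hc.
have : gauss_mean (fun y => cst 2 y + (-1) * cosh (a * y)) <= sech_mean a.
  apply: le_gauss_mean; first exact: gauss_integrableD hk hz.
    exact: gauss_integrable_sech.
  by move=> y; rewrite mulN1r sech_ge.
rewrite (gauss_meanD hk hz) gauss_mean_cst (gauss_meanZ _ hc) gauss_mean_cosh.
rewrite aq; move: (gauss_mean _) => S h; have e := expRxNx (q / 2).
have := @expR_gt1Dx R (- (q / 2)); have -> : - (q / 2) != 0 by lra.
move=> /(_ isT) h2; have u0 := expR_gt0 (- (q / 2)).
have := ler_wpM2l (ltW u0) h; lra.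
Qed.

Lemma gauss_overlap_le q : 0 <= q -> gauss_overlap q <= q.
Proof.
rewrite le_eqVlt => /orP[/eqP<-|/gauss_overlap_lt/ltW//].
by rewrite gauss_overlap0.
Qed.

(** Star-shapedness at [q + e] gives [F (q + e) - F q <= e / (q + e) * F (q + e)], and
    [F (q + e) <= q + e]. *)
Lemma gauss_overlap_lipschitz q e : 0 <= q -> 0 <= e ->
  gauss_overlap (q + e) <= gauss_overlap q + e.
Proof.
move=> q0 e0; have [qe|qe] := eqVneq (q + e) 0.
  have -> : e = 0 by lra.
  by rewrite !addr0.
have qe0 : 0 < q + e by rewrite lt_def qe addr_ge0.
have := @gauss_overlap_star (q / (q + e)) (q + e) (ltW qe0).
rewrite divfK// divr_ge0 ?addr_ge0//= ler_pdivrMr// mul1r lerDl e0 => /(_ isT).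
have := gauss_overlap_le (ltW qe0).
have -> : q / (q + e) = 1 - e / (q + e) by field.
have h1 : 0 <= e / (q + e) by rewrite divr_ge0// ltW.
move=> /(ler_wpM2l h1); rewrite divfK// mulrBl mul1r; lra.
Qed.

(** With [q = 2 ln (1 + h)] the means of [cosh (a Z)] and [cosh (2 a Z)] are [1 + h] and
    [(1 + h) ^ 4], so [sech_le] reduces the claim to a polynomial inequality in [h]; moreover
    [q <= 2 h]. *)
Lemma gauss_overlap_slope r : 0 < r < 1 ->
  exists2 q, 0 < q & r * q <= gauss_overlap q.
Proof.
move=> /andP[r0 r1]; pose h := (1 - r) / 3.
have h0 : 0 < h by rewrite /h; lra.
have s0 : 0 < 1 + h by lra.
have lnh : 0 < ln (1 + h) by rewrite ln_gt0; lra.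
exists (2 * ln (1 + h)); first by rewrite mulr_gt0.
have q0 : 0 <= 2 * ln (1 + h) by rewrite mulr_ge0// ltW.
have lnle : ln (1 + h) <= h by apply: le_ln1Dx; lra.
rewrite gauss_overlapE//.
set a := Num.sqrt _; have aq : a ^+ 2 = 2 * ln (1 + h) by rewrite sqr_sqrtr.
have -> : 2 * ln (1 + h) / 2 = ln (1 + h) by field.
have hc b := gauss_integrable_cosh b.
have hz b (c : R) := gauss_integrableZ c (hc b).
have h7 := gauss_integrable_cst (7 / 2 : R).
have h23 := gauss_integrableD (hz a (- 3)) (hz (2 * a) 2^-1).
have : sech_mean a <= gauss_mean (fun y => cst (7 / 2) y +
    ((- 3) * cosh (a * y) + 2^-1 * cosh ((2 * a) * y))).
  apply: le_gauss_mean; first exact: gauss_integrable_sech.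
    exact: gauss_integrableD h7 h23.
  by move=> y /=; have := sech_le (a * y); rewrite [2 * (a * y)]mulrA; lra.
rewrite (gauss_meanD h7 h23) (gauss_meanD (hz a (- 3)) (hz (2 * a) 2^-1)).
rewrite gauss_mean_cst !(gauss_meanZ _ (hc _)) !gauss_mean_cosh.
have -> : (2 * a) ^+ 2 / 2 = 4%:R * ln (1 + h).
  by rewrite exprMn aq; field.
have -> : a ^+ 2 / 2 = ln (1 + h) by rewrite aq; field.
rewrite mulr_natl expRM_natl lnK ?posrE// expRN lnK ?posrE//.
move: (gauss_mean _) => S hS.
apply: (@le_trans _ _ (r * (2 * h))); first by rewrite ler_pM2l// ler_pM2l.
rewrite -[leLHS]opprK lerNl opprB lerBlDr.
rewrite mulrC ler_pdivrMr//; apply: le_trans hS _.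
have -> : r = 1 - 3 * h by rewrite /h; field.
have h1 : h <= 1 by rewrite /h; lra.
(* This is [(1 - 2 h r) (1 + h)] minus the upper bound for the mean of [1 / cosh], at
   [r = 1 - 3 h]. *)
have : 0 <= h * h * (1 + 4 * h - h * h / 2).
  by rewrite mulr_ge0 ?mulr_ge0 ?(ltW h0)//; nra.
by rewrite !exprS expr0; lra.
Qed.

End GaussOverlap.

(** * The two-task map *)

Section TwoTaskMap.
Context {R : realType}.
Implicit Types (l m k d e s : R).

(** The determinant of [I + D M], where [M] has diagonal [l, m] and product [k] of its off-diagonal
    entries, and [D = diag (d, e)]. Next, [overlap2] is the first diagonal entry of
    [M - M (I + D M)^-1], with nonnegative numerator terms under the hypotheses below. *)
Definition overlap2_den l m k d e : R := 1 + l * d + m * e + (l * m - k) * (d * e).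

Definition overlap2 l m k d e : R :=
  (l ^+ 2 * d + k * e + l * (l * m - k) * (d * e)) / overlap2_den l m k d e.

Section Positive.
Variables (l m k : R).
Hypotheses (l0 : 0 < l) (m0 : 0 < m) (k0 : 0 <= k) (klm : k <= l * m).

Let D0 : 0 <= l * m - k. Proof. by rewrite subr_ge0. Qed.

Lemma overlap2_den_ge1 d e : 0 <= d -> 0 <= e -> 1 <= overlap2_den l m k d e.
Proof.
move=> d0 e0; rewrite /overlap2_den -!addrA lerDl.
by rewrite !addr_ge0// !mulr_ge0// ltW.
Qed.

Lemma overlap2_den_gt0 d e : 0 <= d -> 0 <= e -> 0 < overlap2_den l m k d e.
Proof. by move=> d0 e0; apply: lt_le_trans (overlap2_den_ge1 d0 e0). Qed.

Lemma overlap2E d e : 0 <= d -> 0 <= e ->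
  overlap2 l m k d e = l - (l + (l * m - k) * e) / overlap2_den l m k d e.
Proof.
move=> d0 e0; have P0 := overlap2_den_gt0 d0 e0.
rewrite /overlap2; move: P0; rewrite /overlap2_den => P0; field.
by rewrite gt_eqF.
Qed.

Lemma overlap2_ge d e : 0 <= d -> 0 <= e ->
  (l ^+ 2 * d + k * e) / overlap2_den l m k d e <= overlap2 l m k d e.
Proof.
move=> d0 e0; rewrite ler_pM2r ?invr_gt0 ?overlap2_den_gt0// lerDl.
by rewrite !mulr_ge0// ltW.
Qed.

Lemma overlap2_ge0 d e : 0 <= d -> 0 <= e -> 0 <= overlap2 l m k d e.
Proof.
move=> d0 e0; apply: le_trans (overlap2_ge d0 e0).
apply: divr_ge0; last exact/ltW/overlap2_den_gt0.
by rewrite addr_ge0// mulr_ge0// exprn_ge0// ltW.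
Qed.

Lemma overlap2_bound d e : 0 <= d -> 0 <= e -> overlap2 l m k d e <= l.
Proof.
move=> d0 e0; rewrite overlap2E// lerBlDr lerDl divr_ge0//.
  by rewrite addr_ge0 ?mulr_ge0// ltW.
exact/ltW/overlap2_den_gt0.
Qed.

(** The slope [A] of the denominator in [d] does not depend on [d], so the increment factors as
    [(A / P) (A / P') (d' - d)], with both quotients at most [l]. *)
Lemma overlap2_incrl d d' e : 0 <= d -> 0 <= e -> d <= d' ->
  0 <= overlap2 l m k d' e - overlap2 l m k d e <= l ^+ 2 * (d' - d).
Proof.
move=> d0 e0 dd'; have d'0 := le_trans d0 dd'.
have P0 := overlap2_den_gt0 d0 e0; have P'0 := overlap2_den_gt0 d'0 e0.
set P := overlap2_den _ _ _ _ _ in P0; set P' := overlap2_den _ _ _ _ _ in P'0.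
pose A := l + (l * m - k) * e.
have A0 : 0 <= A by rewrite /A addr_ge0 ?mulr_ge0// ltW.
have -> : overlap2 l m k d' e - overlap2 l m k d e =
    (A / P) * (A / P') * (d' - d).
  rewrite !overlap2E// -/P -/P' -/A.
  have -> : A / P * (A / P') * (d' - d) = A * (A * (d' - d)) / (P * P').
    by field; rewrite !gt_eqF.
  have -> : A * (d' - d) = P' - P.
    by rewrite /A /P /P' /overlap2_den; ring.
  by field; rewrite !gt_eqF.
have AP x : 0 <= x -> A / overlap2_den l m k x e <= l.
  move=> x0; rewrite ler_pdivrMr ?overlap2_den_gt0//.
  rewrite /A /overlap2_den -subr_ge0.
  have -> : l * (1 + l * x + m * e + (l * m - k) * (x * e)) -
     (l + (l * m - k) * e) = l * l * x + k * e + l * (l * m - k) * (x * e) by ring.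
  by rewrite !addr_ge0// !mulr_ge0// ltW.
have dd0 : 0 <= d' - d by rewrite subr_ge0.
have AP0 : 0 <= A / P by rewrite divr_ge0// ltW.
have AP'0 : 0 <= A / P' by rewrite divr_ge0// ltW.
apply/andP; split.
  by apply: mulr_ge0 => //; exact: mulr_ge0.
by apply: ler_wpM2r => //; rewrite expr2; apply: ler_pM => //; exact: AP.
Qed.

Lemma overlap2_incrr d e e' : 0 <= d -> 0 <= e -> e <= e' ->
  0 <= overlap2 l m k d e' - overlap2 l m k d e <= k * (e' - e).
Proof.
move=> d0 e0 ee'; have e'0 := le_trans e0 ee'.
have P0 := overlap2_den_gt0 d0 e0; have P'0 := overlap2_den_gt0 d0 e'0.
have P1 := overlap2_den_ge1 d0 e0; have P'1 := overlap2_den_ge1 d0 e'0.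
have -> : overlap2 l m k d e' - overlap2 l m k d e =
    k * (e' - e) / (overlap2_den l m k d e * overlap2_den l m k d e').
  rewrite /overlap2; move: P0 P'0; rewrite /overlap2_den => P0 P'0.
  by field; rewrite !gt_eqF.
have ke : 0 <= k * (e' - e) by rewrite mulr_ge0// subr_ge0.
have PP0 : 0 < overlap2_den l m k d e * overlap2_den l m k d e' by rewrite mulr_gt0.
rewrite divr_ge0 ?(ltW PP0)//= ler_pdivrMr// ler_peMr//.
by rewrite -[leLHS]mulr1 ler_pM.
Qed.

Lemma le_overlap2 d d' e e' : 0 <= d -> 0 <= e -> d <= d' -> e <= e' ->
  overlap2 l m k d e <= overlap2 l m k d' e'.
Proof.
move=> d0 e0 dd' ee'.
have /andP[h1 _] := overlap2_incrl d0 e0 dd'.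
have /andP[h2 _] := overlap2_incrr (le_trans d0 dd') e0 ee'.
by rewrite !subr_ge0 in h1 h2; apply: le_trans h1 h2.
Qed.

Lemma overlap2_lip d d' e e' : 0 <= d -> 0 <= e -> d <= d' -> e <= e' ->
  overlap2 l m k d' e' <= overlap2 l m k d e + (l ^+ 2 * (d' - d) + k * (e' - e)).
Proof.
move=> d0 e0 dd' ee'.
have /andP[_ h1] := overlap2_incrl d0 e0 dd'.
have /andP[_ h2] := overlap2_incrr (le_trans d0 dd') e0 ee'.
by lra.
Qed.

Lemma overlap2_linear d e : 0 <= d -> 0 <= e ->
  overlap2 l m k d e <= l ^+ 2 * d + k * e.
Proof.
move=> d0 e0; have := overlap2_lip (lexx 0) (lexx 0) d0 e0.
have -> : overlap2 l m k 0 0 = 0 by rewrite /overlap2 !mulr0 !addr0 mul0r.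
by rewrite !subr0 add0r.
Qed.

(** A positive value forces a positive linear part [L]. Over a common denominator the gap has the
    factor [s (1 - s)]. *)
Lemma overlap2_subhomogeneous s d e : 0 <= d -> 0 <= e -> 0 < s < 1 ->
  0 < overlap2 l m k d e -> s * overlap2 l m k d e < overlap2 l m k (s * d) (s * e).
Proof.
move=> d0 e0 /andP[s0 s1] g0.
have sd0 : 0 <= s * d by rewrite mulr_ge0// ltW.
have se0 : 0 <= s * e by rewrite mulr_ge0// ltW.
have P0 := overlap2_den_gt0 d0 e0; have Q0 := overlap2_den_gt0 sd0 se0.
have L0 : 0 < l ^+ 2 * d + k * e.
  have : 0 <= l ^+ 2 * d + k * e by rewrite addr_ge0// mulr_ge0// exprn_ge0// ltW.
  rewrite le_eqVlt => /orP[/eqP L0|//]; have := overlap2_linear d0 e0.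
  by rewrite -L0 leNgt g0.
rewrite -subr_gt0.
pose L := l ^+ 2 * d + k * e; pose f := (l * m - k) * (d * e).
have -> : overlap2 l m k (s * d) (s * e) - s * overlap2 l m k d e =
    s * (1 - s) * (L * (l * d + m * e) - l * f + (1 + s) * L * f + s * l * f * f)
     / (overlap2_den l m k d e * overlap2_den l m k (s * d) (s * e)).
  rewrite /overlap2 /L /f; move: P0 Q0; rewrite /overlap2_den => P0 Q0.
  by field; rewrite !gt_eqF.
apply: divr_gt0; last by rewrite mulr_gt0.
rewrite pmulr_rgt0; last by rewrite mulr_gt0// subr_gt0.
have f0 : 0 <= f by rewrite /f !mulr_ge0.
have de : 0 < l * d + m * e.
  rewrite lt_def addr_ge0 ?mulr_ge0 ?(ltW l0) ?(ltW m0)// andbT.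
  apply/negP => /eqP h; move: L0.
  have ld : 0 <= l * d by rewrite mulr_ge0// ltW.
  have me : 0 <= m * e by rewrite mulr_ge0// ltW.
  have d00 : d = 0 by apply: (mulfI (lt0r_neq0 l0)); rewrite mulr0; lra.
  have e00 : e = 0 by apply: (mulfI (lt0r_neq0 m0)); rewrite mulr0; lra.
  by rewrite d00 e00 !mulr0 addr0 ltxx.
(* The only negative term, [- l f], is absorbed by the product in front of it. *)
have h1 : 0 < L * (l * d + m * e) - l * f.
  have -> : L * (l * d + m * e) - l * f =
    l * l * l * (d * d) + 2 * (l * k * (d * e)) + k * m * (e * e).
    by rewrite /L /f; ring.
  have [dz|dz] := eqVneq d 0.
    have ke : 0 < k * e by move: L0; rewrite dz; lra.
    have ep : 0 < e.
      by rewrite lt_def e0 andbT; apply/eqP => ez; rewrite ez mulr0 ltxx in ke.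
    have -> : l * l * l * (d * d) + 2 * (l * k * (d * e)) + k * m * (e * e) =
        (k * e) * (m * e) by rewrite dz; ring.
    by apply: mulr_gt0 => //; exact: mulr_gt0.
  have dp : 0 < d by rewrite lt_def dz.
  have : 0 < l * l * l * (d * d) by rewrite !mulr_gt0.
  have : 0 <= l * k * (d * e) by rewrite !mulr_ge0// ltW.
  have : 0 <= k * m * (e * e) by rewrite !mulr_ge0// ltW.
  by lra.
have h2 : 0 <= (1 + s) * L * f.
  apply: mulr_ge0 => //; apply: mulr_ge0; last exact: ltW.
  by rewrite addr_ge0// ltW.
have h3 : 0 <= s * l * f * f.
  by apply: mulr_ge0 => //; apply: mulr_ge0 => //; rewrite mulr_ge0// ltW.
by lra.
Qed.

End Positive.
End TwoTaskMap.

(** * From the matrix equations to the scalar formula *)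

Section TwoTasks.
Context {R : realType}.

Lemma det_mx22 (A : 'M[R]_2) :
  \det A = A ord0 ord0 * A ord_max ord_max - A ord0 ord_max * A ord_max ord0.
Proof.
rewrite (expand_det_row _ ord0) !big_ord_recl big_ord0 /cofactor !det_mx11 !mxE /=.
rewrite !addr0 expr0 expr1 mul1r mulN1r mulrN.
by congr (_ * A _ _ - A _ _ * A _ _); apply/val_inj.
Qed.

Lemma sum_ord2 (F : 'I_2 -> R) : \sum_i F i = F ord0 + F ord_max.
Proof. by rewrite !big_ord_recl big_ord0 addr0; congr (_ + F _); apply/val_inj. Qed.

Lemma ord2P (t : 'I_2) : t = ord0 \/ t = ord_max.
Proof. by case: t => -[|[|//]] i; [left|right]; apply/val_inj. Qed.

(** Below, [rev_ord t] denotes the task other than [t], so that one formula covers both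
    coordinates. *)
Lemma rev_ord2_0 : rev_ord ord0 = ord_max :> 'I_2.
Proof. exact/val_inj. Qed.

Lemma rev_ord2_1 : rev_ord ord_max = ord0 :> 'I_2.
Proof. exact/val_inj. Qed.

Lemma noise_level_sq (l : R) : 0 < l -> (noise_level l * noise_level l)^-1 = l.
Proof.
move=> l0; rewrite /noise_level -powRD; last by rewrite (gt_eqF l0) implybT.
have -> : - 2^-1 - 2^-1 = -1 :> R by field.
by rewrite powR_inv1 ?ltW// invrK.
Qed.

Section Map.
Variables (c : R) (lambda : 'I_2 -> R).
Hypotheses (hc : `|c| < 1) (hl : forall t, 0 < lambda t).

Local Notation C := (corr_mx2 c).
Local Notation one := (fun=> 1 : R).
Local Notation G := (overlap_map C lambda one).
Local Notation k := (c ^+ 2 * (lambda ord0 * lambda ord_max)).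

Lemma snr_mx2_diag t : snr_mx C lambda t t = lambda t.
Proof. by rewrite !mxE eqxx mul1r noise_level_sq. Qed.

Lemma snr_mx2_off t : snr_mx C lambda t (rev_ord t) * snr_mx C lambda (rev_ord t) t = k.
Proof.
have e : snr_mx C lambda ord0 ord_max * snr_mx C lambda ord_max ord0 = k.
  rewrite !mxE /= -[in RHS](noise_level_sq (hl ord0)) -[in RHS](noise_level_sq (hl ord_max)).
  by rewrite !invfM; ring.
by case: (ord2P t) => ->; rewrite ?rev_ord2_0 ?rev_ord2_1// mulrC.
Qed.

Lemma corr_ge0 : 0 <= k.
Proof. by rewrite mulr_ge0 ?sqr_ge0// mulr_ge0// ltW. Qed.

Lemma corr_le t : k <= lambda t * lambda (rev_ord t).
Proof.
have h : k <= lambda ord0 * lambda ord_max.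
  rewrite ler_piMl ?mulr_ge0 ?(ltW (hl _))// -[leRHS](expr1n _ 2) -(real_normK (num_real c)).
  by rewrite ler_pXn2r ?nnegrE// ltW.
by case: (ord2P t) => ->; rewrite ?rev_ord2_0 ?rev_ord2_1// [leRHS]mulrC.
Qed.

Lemma overlap2_denC (l m k' d e : R) : overlap2_den m l k' e d = overlap2_den l m k' d e.
Proof. by rewrite /overlap2_den; ring. Qed.

Lemma qu_of_qv2E (v : 'rV[R]_2) t : nonneg_row v ->
  qu_of_qv C lambda one v 0 t =
  overlap2 (lambda t) (lambda (rev_ord t)) k (v 0 t) (v 0 (rev_ord t)).
Proof.
move=> v0; rewrite overlap2E//; try exact: corr_ge0; try exact: corr_le.
rewrite /qu_of_qv; set M := snr_mx C lambda.
set N := 1%:M + _; set W := M *m invmx N.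
rewrite [LHS]mxE [LHS]mxE [X in _ + X]mxE.
have NE i j : N i j = (i == j)%:R + v 0 i * M i j.
  by rewrite /N mul_diag_mx !mxE mul1r.
have M00 : M ord0 ord0 = lambda ord0 by exact: snr_mx2_diag.
have M11 : M ord_max ord_max = lambda ord_max by exact: snr_mx2_diag.
have M01 : M ord0 ord_max * M ord_max ord0 = k.
  by have := snr_mx2_off ord0; rewrite rev_ord2_0.
pose P := overlap2_den (lambda ord0) (lambda ord_max) k (v 0 ord0) (v 0 ord_max).
have P0 : 0 < P.
  apply: overlap2_den_gt0 => //.
  by have := corr_le ord0; rewrite rev_ord2_0.
have dN : \det N = P.
  rewrite det_mx22 !NE /= M00 M11 /P /overlap2_den -M01; ring.
have uN : N \in unitmx by rewrite unitmxE dN unitfE gt_eqF.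
(* The inverse is never computed: the diagonal entries of [W] are read off from this linear system
   by Cramer's rule. *)
have WN : W *m N = M by rewrite mulmxKV.
have WE i j : W i ord0 * N ord0 j + W i ord_max * N ord_max j = M i j.
  by rewrite -[RHS](congr1 (fun A : 'M[R]_2 => A i j) WN) [RHS]mxE sum_ord2.
have Md s : M s s = lambda s by exact: snr_mx2_diag.
rewrite Md; congr (_ - _).
case: (ord2P t) => ->; rewrite ?rev_ord2_0 ?rev_ord2_1.
  rewrite -/P; apply: (mulIf (lt0r_neq0 P0)); rewrite divfK ?gt_eqF//.
  transitivity (M ord0 ord0 * N ord_max ord_max - M ord0 ord_max * N ord_max ord0).
    by rewrite -!WE -dN det_mx22; ring.
  by rewrite !NE /= M00 M11 -M01; ring.
rewrite overlap2_denC -/P; apply: (mulIf (lt0r_neq0 P0)); rewrite divfK ?gt_eqF//.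
transitivity (M ord_max ord_max * N ord0 ord0 - M ord_max ord0 * N ord0 ord_max).
  by rewrite -!WE -dN det_mx22; ring.
by rewrite !NE /= M00 M11 -M01; ring.
Qed.

Lemma nonneg_qv_of_qu (q : 'rV[R]_2) : nonneg_row q -> nonneg_row (qv_of_qu q).
Proof. by move=> q0 t; rewrite mxE gauss_overlap_ge0. Qed.

Lemma overlap_map2E (q : 'rV[R]_2) t : nonneg_row q -> G q 0 t =
  overlap2 (lambda t) (lambda (rev_ord t)) k
    (gauss_overlap (q 0 t)) (gauss_overlap (q 0 (rev_ord t))).
Proof. by move=> q0; rewrite qu_of_qv2E ?mxE//; exact: nonneg_qv_of_qu. Qed.

(** Stated for any [H] with this coordinate formula, which keeps the matrix inverse out of the
    argument. The last constant dominates [lambda t ^ 2 + k] for both tasks. *)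
Lemma two_task_map_subhomogeneous (H : 'rV[R]_2 -> 'rV[R]_2) :
  (forall q t, nonneg_row q -> H q 0 t =
    overlap2 (lambda t) (lambda (rev_ord t)) k
      (gauss_overlap (q 0 t)) (gauss_overlap (q 0 (rev_ord t)))) ->
  subhomogeneous_map H (\row_t lambda t) (\sum_t lambda t ^+ 2 + k).
Proof.
move=> HE.
have F0 (q : 'rV[R]_2) t : nonneg_row q -> 0 <= gauss_overlap (q 0 t).
  by move=> q0; exact: gauss_overlap_ge0.
split; first split.
- by move=> x x0 t; rewrite HE// overlap2_ge0 ?F0 ?corr_ge0 ?corr_le.
- move=> x y x0 xy t; have y0 := nonneg_row_le x0 xy.
  rewrite (HE _ t x0) (HE _ t y0) le_overlap2 ?F0 ?corr_ge0 ?corr_le//;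
  by rewrite le_gauss_overlap.
- move=> x x0 t; rewrite HE// mxE.
  by rewrite overlap2_bound ?F0 ?corr_ge0 ?corr_le.
- move=> x s t x0 s01; have /andP[s0 s1] := s01.
  have sx0 : nonneg_row (s *: x) by apply: nonneg_rowZ => //; exact: ltW.
  rewrite (HE _ t x0) (HE _ t sx0) => g0.
  have s01' : 0 <= s <= 1 by rewrite (ltW s0) (ltW s1).
  apply: lt_le_trans (overlap2_subhomogeneous _ _ _ _ _ _ s01 g0) _;
    rewrite ?F0 ?corr_ge0 ?corr_le//.
  have star u : s * gauss_overlap (x 0 u) <= gauss_overlap ((s *: x) 0 u).
    by rewrite mxE; exact: gauss_overlap_star.
  apply: le_overlap2; rewrite ?corr_ge0 ?corr_le//;
    by rewrite mulr_ge0 ?F0 ?(ltW s0).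
- move=> x e x0 e0 t; have ce0 : nonneg_row (x + const_mx e).
    by move=> s; rewrite !mxE addr_ge0.
  have xE s : (x + const_mx e) 0 s = x 0 s + e by rewrite !mxE.
  rewrite (HE _ t ce0) [leRHS]mxE (HE _ t x0) !xE [X in _ <= _ + X]mxE.
  have mono s : gauss_overlap (x 0 s) <= gauss_overlap (x 0 s + e).
    by rewrite le_gauss_overlap// lerDl.
  apply: le_trans (overlap2_lip _ _ _ _ _ _ (mono t) (mono (rev_ord t))) _;
    rewrite ?F0 ?corr_ge0 ?corr_le//.
  rewrite lerD2l mulrDl lerD//.
    rewrite ler_pM ?sqr_ge0 ?subr_ge0//; last first.
      by rewrite lerBlDl gauss_overlap_lipschitz.
    by rewrite (bigD1 t)//= lerDl sumr_ge0// => i _; exact: sqr_ge0.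
  by rewrite ler_wpM2l ?corr_ge0// lerBlDl gauss_overlap_lipschitz.
Qed.

Lemma overlap_map2_subhomogeneous :
  subhomogeneous_map G (\row_t lambda t) (\sum_t lambda t ^+ 2 + k).
Proof. by apply: two_task_map_subhomogeneous => q t; exact: overlap_map2E. Qed.

End Map.
End TwoTasks.

(** * The impossible region *)

Section Region.
Context {R : realType}.
Implicit Types (l m k x y v w : R).

(** Write [X = F x], [Y = F y]. If [x, y > 0], then [X < x <= l ^ 2 X + k Y] and its mirror image
    multiply to [(1 - l ^ 2) (1 - m ^ 2) X Y < k ^ 2 X Y], a contradiction. If only [x] is positive,
    [x <= l ^ 2 X <= X < x]. *)
Lemma fixpoint_zero_of_region l m k x y : 0 < l -> 0 < m -> 0 <= k -> k <= l * m ->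
  l <= 1 -> m <= 1 -> k ^+ 2 <= (1 - l ^+ 2) * (1 - m ^+ 2) ->
  0 <= x -> 0 <= y ->
  x = overlap2 l m k (gauss_overlap x) (gauss_overlap y) ->
  y = overlap2 m l k (gauss_overlap y) (gauss_overlap x) ->
  x = 0 /\ y = 0.
Proof.
move=> l0 m0 k0 klm l1 m1 hk x0 y0 ex ey.
have X0 := gauss_overlap_ge0 x0; have Y0 := gauss_overlap_ge0 y0.
have kml : k <= m * l by rewrite mulrC.
have := overlap2_linear l0 m0 k0 klm X0 Y0; rewrite -ex.
have := overlap2_linear m0 l0 k0 kml Y0 X0; rewrite -ey.
have Xz := @gauss_overlap_lt R x; have Yz := @gauss_overlap_lt R y.
have Xx := gauss_overlap_le x0; have Yy := gauss_overlap_le y0.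
have X0z : x = 0 -> gauss_overlap x = 0 by move=> ->; exact: gauss_overlap0.
have Y0z : y = 0 -> gauss_overlap y = 0 by move=> ->; exact: gauss_overlap0.
move: (gauss_overlap x) (gauss_overlap y) X0 Y0 Xz Yz Xx Yy X0z Y0z {ex ey}.
move=> X Y X0 Y0 Xz Yz Xx Yy X0z Y0z hy hx.
have M1 : 0 <= 1 - l ^+ 2 by rewrite subr_ge0 expr_le1// ltW.
have M2 : 0 <= 1 - m ^+ 2 by rewrite subr_ge0 expr_le1// ltW.
have key : 0 < x -> 0 < y -> False.
  move=> xp yp.
  have h1 : (1 - l ^+ 2) * X < k * Y by have := Xz xp; lra.
  have h2 : (1 - m ^+ 2) * Y < k * X by have := Yz yp; lra.
  have a0 : 0 <= (1 - l ^+ 2) * X by rewrite mulr_ge0.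
  have b0 : 0 <= (1 - m ^+ 2) * Y by rewrite mulr_ge0.
  have := ltr_pM a0 b0 h1 h2.
  have : k ^+ 2 * (X * Y) <= (1 - l ^+ 2) * (1 - m ^+ 2) * (X * Y).
    by rewrite ler_wpM2r// mulr_ge0.
  by rewrite expr2; lra.
have [xz|xnz] := eqVneq x 0; have [yz|ynz] := eqVneq y 0 => //.
- have yp : 0 < y by rewrite lt_def ynz.
  have hY := Yz yp.
  have : m ^+ 2 * Y <= Y by rewrite ler_piMl// -subr_ge0.
  by move: hy; rewrite X0z// mulr0 addr0; lra.
- have xp : 0 < x by rewrite lt_def xnz.
  have hX := Xz xp.
  have : l ^+ 2 * X <= X by rewrite ler_piMl// -subr_ge0.
  by move: hx; rewrite Y0z// mulr0 addr0; lra.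
- by exfalso; apply: key; rewrite lt_def ?xnz ?ynz.
Qed.

(* Outside the region the matrix [[l^2, k], [k, m^2]] has spectral radius
   above 1; [v, w] is an explicit approximate Perron vector. *)
Lemma expanding_direction l m k : 0 < l -> 0 < m -> 0 <= k ->
  ~ [/\ l <= 1, m <= 1 & k ^+ 2 <= (1 - l ^+ 2) * (1 - m ^+ 2)] ->
  exists v w kappa, [/\ 0 <= v, 0 <= w, 0 < v + w, 1 < kappa &
    kappa * v <= l ^+ 2 * v + k * w /\ kappa * w <= m ^+ 2 * w + k * v].
Proof.
move=> l0 m0 k0 hn.
(* A task with ratio above 1 expands along its own coordinate axis. *)
have [l1|l1] := ltP 1 l.
  exists 1, 0, (l ^+ 2); split; rewrite ?addr0//; first by rewrite exprn_egt1.
  by rewrite !mulr0 !mulr1; split; lra.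
have [m1|m1] := ltP 1 m.
  exists 0, 1, (m ^+ 2); split; rewrite ?add0r//; first by rewrite exprn_egt1.
  by rewrite !mulr0 !mulr1; split; lra.
have hk : (1 - l ^+ 2) * (1 - m ^+ 2) < k ^+ 2.
  by rewrite ltNge; apply/negP => h; apply: hn.
have a0 : 0 <= 1 - l ^+ 2 by rewrite subr_ge0 expr_le1// ltW.
have b0 : 0 <= 1 - m ^+ 2 by rewrite subr_ge0 expr_le1// ltW.
have a1 : 1 - l ^+ 2 <= 1 by rewrite gerBl exprn_ge0// ltW.
have b1 : 1 - m ^+ 2 <= 1 by rewrite gerBl exprn_ge0// ltW.
move: (l ^+ 2) (m ^+ 2) hk a0 b0 a1 b1 => p q hk a0 b0 a1 b1.
(* For the vector [(k, w)] the first row gives exactly [(1 + eps) k], and the second gains at least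
   [eps] over [w]. Since [w <= 1 + eps], the factor [1 + eps / (1 + eps)] suits both rows. *)
pose eps := (k ^+ 2 - (1 - p) * (1 - q)) / 2.
have e0 : 0 < eps by rewrite /eps; lra.
pose w := 1 - p + eps.
have w0 : 0 < w by rewrite /w; lra.
have w1 : w <= 1 + eps by rewrite /w; lra.
have f0 : 0 < eps / (1 + eps) by rewrite divr_gt0//; lra.
have fe : eps / (1 + eps) <= eps by rewrite ler_pdivrMr; nra.
have fw : eps / (1 + eps) * w <= eps.
  by rewrite mulrAC ler_pdivrMr ?ler_pM2l//; lra.
exists k, w, (1 + eps / (1 + eps)); split; [by []|exact: ltW|lra|lra|].
split.
  have : eps / (1 + eps) * k <= eps * k by rewrite ler_wpM2r.
  by rewrite /w; lra.
have : (1 - q) * eps <= eps by rewrite ler_piMl// ltW.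
have E : k ^+ 2 = 2 * eps + (1 - p) * (1 - q) by rewrite /eps; field.
have : w * (1 - q) = (1 - p) * (1 - q) + (1 - q) * eps by rewrite /w; ring.
move: E; rewrite expr2 mulrDl mul1r; lra.
Qed.

(** For a small multiple of [(v, w)], replacing [F] by the identity costs a factor [rho] and the
    denominator costs at most [rho kappa]; the expansion by [kappa] pays for both. *)
Lemma exists_subsolution l m k v w kappa : 0 < l -> 0 < m -> 0 <= k -> k <= l * m ->
  0 <= v -> 0 <= w -> 0 < v + w -> 1 < kappa ->
  kappa * v <= l ^+ 2 * v + k * w -> kappa * w <= m ^+ 2 * w + k * v ->
  exists2 tau, 0 < tau &
    tau * v <= overlap2 l m k (gauss_overlap (tau * v)) (gauss_overlap (tau * w)) /\
    tau * w <= overlap2 m l k (gauss_overlap (tau * w)) (gauss_overlap (tau * v)).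
Proof.
move=> l0 m0 k0 klm v0 w0 vw kp h1 h2.
have kp0 : 0 < kappa by lra.
(* The midpoint of [1 / kappa] and 1, so that [rho < 1 < rho kappa]. *)
pose rho := (1 + kappa^-1) / 2.
have ki : 0 < kappa^-1 < 1 by rewrite invr_gt0 kp0 invf_lt1.
have rho01 : 0 < rho < 1 by rewrite /rho; lra.
have rk : rho * kappa = (kappa + 1) / 2 by rewrite /rho; field; rewrite gt_eqF.
have [q0 q0p hq0] := gauss_overlap_slope rho01.
(* Star-shapedness spreads the slope bound from the single point [q0] to all of [[0, q0]]. *)
have slope x : 0 <= x -> x <= q0 -> rho * x <= gauss_overlap x.
  move=> x0 xq; have s01 : 0 <= x / q0 <= 1.
    by rewrite divr_ge0 ?(ltW q0p)//= ler_pdivrMr// mul1r.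
  have := gauss_overlap_star (ltW q0p) s01; rewrite divfK ?gt_eqF//.
  apply: le_trans; case/andP: s01 => s0 _.
  apply: le_trans (ler_wpM2l s0 hq0).
  by rewrite mulrCA divfK ?gt_eqF.
(* [K u] bounds the excess of the denominator over 1, and [rho kappa - 1 = (kappa - 1) / 2]. *)
pose K := l + m + l * m.
have K0 : 0 < K by rewrite /K !addr_gt0// mulr_gt0.
pose u := Num.min 1 (Num.min q0 ((kappa - 1) / (2 * K))).
have u0 : 0 < u.
  by rewrite !lt_min ltr01 q0p divr_gt0// ?subr_gt0// mulr_gt0.
have u1 : u <= 1 by rewrite ge_min lexx.
have uq : u <= q0 by rewrite !ge_min lexx !orbT.
have uK : K * u <= (kappa - 1) / 2.
  have : u <= (kappa - 1) / (2 * K) by rewrite !ge_min lexx !orbT.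
  by rewrite ler_pdivlMr ?mulr_gt0//; lra.
pose tau := u / (v + w).
have tau0 : 0 < tau by rewrite divr_gt0.
have tE : tau * v + tau * w = u by rewrite -mulrDr divfK// gt_eqF.
have tv0 : 0 <= tau * v by rewrite mulr_ge0// ltW.
have tw0 : 0 <= tau * w by rewrite mulr_ge0// ltW.
have tvu : tau * v <= u by lra.
have twu : tau * w <= u by lra.
have sv := slope _ tv0 (le_trans tvu uq); have sw := slope _ tw0 (le_trans twu uq).
have bv := gauss_overlap_le tv0; have bw := gauss_overlap_le tw0.
have pv := gauss_overlap_ge0 tv0; have pw := gauss_overlap_ge0 tw0.
exists tau => //.
move: (gauss_overlap (tau * v)) (gauss_overlap (tau * w)) sv sw bv bw pv pw.
move=> X Y sv sw bv bw pv pw.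
have XYu : X * Y <= u.
  rewrite -[u]mulr1; apply: ler_pM => //; lra.
have PK : overlap2_den l m k X Y <= rho * kappa.
  rewrite rk /overlap2_den.
  have : l * X <= l * u by rewrite ler_pM2l//; lra.
  have : m * Y <= m * u by rewrite ler_pM2l//; lra.
  have : (l * m - k) * (X * Y) <= l * m * u.
    apply: ler_pM => //; rewrite ?subr_ge0 ?mulr_ge0//; lra.
  by move: uK; rewrite /K; lra.
have rho0 : 0 < rho by case/andP: rho01.
have main a b x y (z : R) : 0 < a -> 0 < b -> k <= a * b -> 0 <= x -> 0 <= y -> 0 <= z ->
    overlap2_den a b k x y <= rho * kappa ->
    rho * (kappa * z) <= a ^+ 2 * x + k * y -> z <= overlap2 a b k x y.
  move=> a0 b0 kab x0 y0 z0 hP hz.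
  apply: le_trans (overlap2_ge a0 b0 kab x0 y0).
  rewrite ler_pdivlMr; last exact: overlap2_den_gt0.
  apply: le_trans hz; rewrite mulrA [leRHS]mulrC.
  exact: ler_wpM2l.
split.
- apply: main => //.
  apply: (@le_trans _ _ (l ^+ 2 * (rho * (tau * v)) + k * (rho * (tau * w)))).
    have := ler_wpM2l (mulr_ge0 (ltW rho0) (ltW tau0)) h1; lra.
  by rewrite lerD// ler_wpM2l// exprn_ge0// ltW.
- apply: main => //; first by rewrite mulrC.
    by rewrite overlap2_denC.
  apply: (@le_trans _ _ (m ^+ 2 * (rho * (tau * w)) + k * (rho * (tau * v)))).
    have := ler_wpM2l (mulr_ge0 (ltW rho0) (ltW tau0)) h2; lra.
  by rewrite lerD// ler_wpM2l// exprn_ge0// ltW.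
Qed.

End Region.

(** Outside the region a nonzero subsolution lies below [q]; inside it, [fixpoint_zero_of_region]
    applies to the fixed point [q] itself. *)
Lemma max_fixpoint_zero_iff (R : realType) (c : R) (lambda : 'I_2 -> R)
    (q : 'rV[R]_2) : `|c| < 1 -> (forall t, 0 < lambda t) ->
  max_fixpoint (overlap_map (corr_mx2 c) lambda (fun=> 1)) q ->
  (forall t, impossible_task q t) <->
  impossible_region c (lambda ord0, lambda ord_max).
Proof.
move=> hc hl [q0 Gq qmax].
have GE (x : 'rV[R]_2) t := @overlap_map2E R c lambda hc hl x t.
have k0 := @corr_ge0 R c lambda hl.
have k1 := @corr_le R c lambda hc hl ord0.
have k2 := @corr_le R c lambda hc hl ord_max.
set k := c ^+ 2 * _ in GE k0 k1 k2.
have l0 := hl ord0; have m0 := hl ord_max.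
rewrite rev_ord2_0 in k1; rewrite rev_ord2_1 in k2.
have kE : k ^+ 2 = c ^+ 4 * lambda ord0 ^+ 2 * lambda ord_max ^+ 2.
  by rewrite /k; ring.
split.
  move=> qz; apply: contrapT => nreg.
  have [|v [w [kappa [v0 w0 vw kp [h1 h2]]]]] :=
      @expanding_direction R (lambda ord0) (lambda ord_max) k l0 m0 k0.
    move=> [l1 m1 hk]; apply: nreg; split => /=; rewrite ?l1 ?m1 ?andbT.
    - exact: ltW.
    - exact: ltW.
    - by rewrite -kE.
  have [tau tau0 [s1 s2]] := exists_subsolution l0 m0 k0 k1 v0 w0 vw kp h1 h2.
  pose x : 'rV[R]_2 := \row_t if t == ord0 then tau * v else tau * w.
  have xE0 : x 0 ord0 = tau * v by rewrite mxE.
  have xE1 : x 0 ord_max = tau * w by rewrite mxE.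
  have x0 : nonneg_row x.
    by move=> t; case: (ord2P t) => ->; rewrite ?xE0 ?xE1 mulr_ge0// ltW.
  have xq : le_row x q.
    apply: qmax => // t; rewrite (GE x t x0).
    by case: (ord2P t) => ->; rewrite ?rev_ord2_0 ?rev_ord2_1 ?xE0 ?xE1.
  have := xq ord0; have := xq ord_max; rewrite xE0 xE1.
  have -> : q 0 ord0 = 0 by exact: qz.
  have -> : q 0 ord_max = 0 by exact: qz.
  have := mulr_gt0 tau0 vw; lra.
move=> [/andP[_ /= l1] /andP[_ /= m1] /=]; rewrite -kE => hk t.
have e1 := GE q ord0 q0; have e2 := GE q ord_max q0.
rewrite Gq rev_ord2_0 in e1; rewrite Gq rev_ord2_1 in e2.
have [z1 z2] := fixpoint_zero_of_region l0 m0 k0 k1 l1 m1 hk (q0 _) (q0 _) e1 e2.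
by case: (ord2P t) => ->.
Qed.

(** The first conjunct shows that the overlaps are well defined, so the equivalence is not
    vacuous. *)
Theorem mainTheorem4 (R : realType) (c : R) (hc : `|c| < 1)
    (lambda : 'I_2 -> R) (hlambda : forall t, 0 < lambda t) :
  let alpha : 'I_2 -> R := fun=> 1 in
  (exists! q : 'rV[R]_2 * 'rV[R]_2,
     is_overlaps (corr_mx2 c) lambda alpha q.1 q.2) /\
  (forall qu qv : 'rV[R]_2,
     is_overlaps (corr_mx2 c) lambda alpha qu qv ->
     ((forall t, impossible_task qu t) <->
      impossible_region c (lambda ord0, lambda ord_max))).
Proof.
move=> alpha.
have HG := overlap_map2_subhomogeneous hc hlambda.
have [q Mq] := exists_max_fixpoint (sh_bm HG).
have [q0 Gq _] := Mq.
(* Since [qv] is a function of [qu], uniqueness of the pair reduces to [qu]. *)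
have uniq qu qv : is_overlaps (corr_mx2 c) lambda alpha qu qv -> qu = q.
  move=> [qu0 _ e1 e2 st]; apply: (stable_fixpoint_unique HG Mq qu0) => //.
  by rewrite /overlap_map -e2.
split; last by move=> qu qv /uniq ->; exact: max_fixpoint_zero_iff.
exists (q, qv_of_qu q); split => [|[qu qv] /= H].
  split => //=; first exact: nonneg_qv_of_qu.
  exact: (max_fixpoint_stable HG Mq).
by have := uniq _ _ H; case: H => _ _ _ -> _ ->.
Qed.
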